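(* Let $\alpha=\frac{\pi}{4}$, $\beta=\frac{2\pi}{3}$, $\gamma=\frac{\pi}{3}$, $\delta=\frac{\pi}{4}$. Consider a $3\times 4$-net of strictly convex quadrilaterals (3 rows and 4 columns of faces $F_{i,j}$, $1\le i\le 3$, $1\le j\le 4$, glued in the combinatorics of the square grid, with vertices $p_{i,j}$, $0\le i\le 3$, $0\le j\le 4$) whose face angles at the six interior vertices $p_{i,j}$, $i\in\{1,2\}$, $j\in\{1,2,3\}$, are as follows, for $i=1$ and $i=2$: - at $p_{i,1}$: the two faces in column $1$ have angle $\alpha$, the two faces in column $2$ have angle $\beta$; - at $p_{i,2}$: all four faces have angle $\gamma$; - at $p_{i,3}$: the two faces in column $3$ have angle $\beta$; of the two faces in column $4$, the one in the middle row ($F_{2,4}$) has angle $2\alpha+\delta$, and the other one ($F_{1,4}$ for $i=1$, $F_{3,4}$ for $i=2$) has angle $\delta$. Then this net has a realization in $\mathbb{R}^3$ as a discrete conjugate net such that, denoting by $\varphi_j$ ($j=0,1,2,3$) the exterior dihedral angle at the edge $p_{i,j}p_{i,j+1}$ (the same for $i=1$ and $i=2$), one has $$\varphi_0=0,\qquad \varphi_1=\varphi_2,\qquad \varphi_3=\pi,$$ and such that this realization is not flexible, while both of its $3\times 3$-subnets (the one formed by the face columns $1,2,3$ and the one formed by the face columns $2,3,4$) are flexible.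
   Context: An $m\times n$ discrete conjugate net is a polyhedral surface in $\mathbb{R}^3$ with planar quadrilateral faces connected in the combinatorics of an $m\times n$ square grid of faces: points $p_{i,j}\in\mathbb{R}^3$, $0\le i\le m$, $0\le j\le n$, such that $p_{i-1,j-1},p_{i-1,j},p_{i,j},p_{i,j-1}$ are, in this cyclic order, the vertices of a planar quadrilateral (the face $F_{i,j}$ in row $i$ and column $j$). Self-intersections and overlaps of faces are allowed. A realization of a net of given quadrilaterals is a discrete conjugate net whose faces are congruent to the given quadrilaterals. Exterior dihedral angle: fix orientations of the ambient space and of the surface. For an interior edge choose one of its two orientations; the exterior dihedral angle (an element of $\mathbb{R}/2\pi\mathbb{Z}$) is the angle by which the face on the right hand side has to be rotated about the oriented edge so as to become coplanar but not overlapping with the face on the left hand side. It does not depend on the orientation of the edge. Thus $0$ means that the two faces are coplanar and lie on different sides of the edge, and $\pi$ means that they are folded onto each other. An isometric deformation of a net is a one-parameter smooth family of discrete conjugate nets (same combinatorics), starting from the given net at $t=0$, $t\in(-\varepsilon,\varepsilon)$, in which every face undergoes a rigid motion of space (each face $F$ at time $t$ is the image of the original face under an orientation-preserving isometry $g_F(t)$, smooth in $t$, $g_F(0)=\mathrm{id}$). It is trivial if all faces undergo the same rigid motion. A net is flexible if it admits a non-trivial isometric deformation, and rigid otherwise. *)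

(* Defs.v *)
From mathcomp Require Import all_boot all_order all_algebra.
From mathcomp Require Import boolp classical_sets functions reals.
From mathcomp Require Import topology normedtype derive trigo.

Set Implicit Arguments.
Unset Strict Implicit.
Unset Printing Implicit Defensive.

Import Order.TTheory GRing.Theory Num.Theory.
Import numFieldNormedType.Exports.

Local Open Scope classical_set_scope.
Local Open Scope ring_scope.

(* Points of R^n are row vectors.  The norm `|_| that the library puts on
   matrices is the sup norm, hence the separate Euclidean norm below. *)
Definition dotp (R : realType) (n : nat) (u v : 'rV[R]_n) : R :=
  \sum_k u 0 k * v 0 k.

Definition enorm (R : realType) (n : nat) (u : 'rV[R]_n) : R :=
  Num.sqrt (dotp u u).

Definition edist (R : realType) (n : nat) (a b : 'rV[R]_n) : R :=
  enorm (b - a).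

(* Addition on 'I_3 is modulo 3. *)
Definition cross (R : realType) (u v : 'rV[R]_3) : 'rV[R]_3 :=
  \row_(k < 3) (u 0 (k + 1) * v 0 (k + 2) - u 0 (k + 2) * v 0 (k + 1)).

(* Rodrigues' formula; u is meant to be a unit vector, and the rotation is
   counterclockwise when u points towards the observer. *)
Definition rotation (R : realType) (u : 'rV[R]_3) (theta : R) (v : 'rV[R]_3) :
    'rV[R]_3 :=
  cos theta *: v + sin theta *: cross u v
    + ((1 - cos theta) * dotp u v) *: u.

Definition segment (R : realType) (n : nat) (a b : 'rV[R]_n) :
    set 'rV[R]_n :=
  [set x | exists2 s : R, 0 <= s <= 1 & x = (1 - s) *: a + s *: b].

(* A quadrilateral is given by its vertices in cyclic order, indexed by 'I_4;
   addition on 'I_4 is modulo 4. *)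
Definition quad (R : realType) (n : nat) : Type := 'I_4 -> 'rV[R]_n.

Definition angle (R : realType) (n : nat) (q : quad R n) (k : 'I_4) : R :=
  acos (dotp (q (k - 1) - q k) (q (k + 1) - q k)
        / (edist (q k) (q (k - 1)) * edist (q k) (q (k + 1)))).

(* The sign tells on which side of the oriented line ab the point x lies. *)
Definition side_of_line (R : realType) (a b x : 'rV[R]_2) : R :=
  \det (col_mx (b - a) (x - a) : 'M[R]_(1 + 1)).

(* For every side, the two remaining vertices lie strictly on the same side
   of the line through it. *)
Definition strictly_convex (R : realType) (q : quad R 2) : Prop :=
  forall k : 'I_4,
    0 < side_of_line (q k) (q (k + 1)) (q (k + 2))
        * side_of_line (q k) (q (k + 1)) (q (k + 3)).

Definition coplanar (R : realType) (q : quad R 3) : Prop :=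
  exists (v : 'rV[R]_3) (c : R), v != 0 /\ forall k, dotp v (q k) = c.

(* The closed polygonal line has no self-intersection. *)
Definition simple_quad (R : realType) (n : nat) (q : quad R n) : Prop :=
  forall k : 'I_4,
    segment (q k) (q (k + 1)) `&` segment (q (k + 1)) (q (k + 2))
      = [set q (k + 1)]
    /\ segment (q k) (q (k + 1)) `&` segment (q (k + 2)) (q (k + 3)) = set0.

Definition congruent (R : realType) (m n : nat) (q : quad R m) (q' : quad R n) :
    Prop :=
  exists f : 'rV[R]_m -> 'rV[R]_n,
    (forall x y, edist (f x) (f y) = edist x y) /\ (forall k, f (q k) = q' k).

(* An m x n net has vertices p i j with 0 <= i <= m, 0 <= j <= n and faces
   F_{i,j} with 1 <= i <= m, 1 <= j <= n; the values of p at other indices are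
   irrelevant. *)
Definition vertices (R : realType) : Type := nat -> nat -> 'rV[R]_3.

Definition is_face (m n i j : nat) : bool :=
  ((1 <= i <= m) && (1 <= j <= n))%N.

(* The rows of the grid are drawn from top to bottom, the columns from left to
   right. *)
Definition top_left : 'I_4 := 0.
Definition top_right : 'I_4 := 1.
Definition bottom_right : 'I_4 := 2.
Definition bottom_left : 'I_4 := 3.

Definition face (R : realType) (p : vertices R) (i j : nat) : quad R 3 :=
  fun k => tnth [tuple p i.-1 j.-1; p i.-1 j; p i j; p i j.-1] k.

Definition conjugate_net (R : realType) (m n : nat) (p : vertices R) : Prop :=
  forall i j, is_face m n i j ->
    coplanar (face p i j) /\ simple_quad (face p i j).

(* Abstract gluing data: Q i j is the face F_{i,j} laid out in the plane, and
   sides identified in the square grid have equal lengths. *)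
Definition net_of_quads (R : realType) (m n : nat)
    (Q : nat -> nat -> quad R 2) : Prop :=
  [/\ forall i j, is_face m n i j -> strictly_convex (Q i j),
      forall i j, is_face m n i j -> is_face m n i j.+1 ->
        edist (Q i j top_right) (Q i j bottom_right)
        = edist (Q i j.+1 top_left) (Q i j.+1 bottom_left)
    & forall i j, is_face m n i j -> is_face m n i.+1 j ->
        edist (Q i j bottom_left) (Q i j bottom_right)
        = edist (Q i.+1 j top_left) (Q i.+1 j top_right)].

Definition realization (R : realType) (m n : nat)
    (Q : nat -> nat -> quad R 2) (p : vertices R) : Prop :=
  conjugate_net m n p
  /\ forall i j, is_face m n i j -> congruent (Q i j) (face p i j).

Definition half_plane (R : realType) (a u w : 'rV[R]_3) : set 'rV[R]_3 :=
  [set x | exists s t : R, 0 <= t /\ x = a + s *: u + t *: w].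

(* theta represents, modulo 2 pi, the exterior dihedral angle at the edge ab,
   oriented from a to b, between the faces l on its left and r on its right:
   after r has been rotated by theta about the edge, l and r lie in opposite
   half-planes bounded by the line ab.  The faces are assumed to be convex, so
   that each of them lies in one half-plane. *)
Definition exterior_dihedral_angle (R : realType) (a b : 'rV[R]_3)
    (l r : quad R 3) (theta : R) : Prop :=
  let u := (edist a b)^-1 *: (b - a) in
  exists w : 'rV[R]_3,
    [/\ w != 0, dotp u w = 0,
        forall k, half_plane a u w (l k)
      & forall k, half_plane a u (- w) (a + rotation u theta (r k - a))].

(* The edge p_{i,j} p_{i,j+1}, oriented in the direction of increasing j.  The
   surface is oriented so that F_{i,j+1} lies to the left of it; the opposite
   choice changes the sign of all angles. *)
Definition row_dihedral_angle (R : realType) (p : vertices R) (i j : nat)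
    (theta : R) : Prop :=
  exterior_dihedral_angle (p i j) (p i j.+1)
    (face p i j.+1) (face p i.+1 j.+1) theta.

Definition smooth_near0 (R : realType) (eps : R) (f : R -> R) : Prop :=
  forall (k : nat) (t : R), - eps < t < eps -> derivable (derive1n k f) t 1.

(* The motion g_F(t) of F = F_{i,j} is x |-> x *m A i j t + b i j t.  Each
   vertex lies on a face, so it moves smoothly as well. *)
Definition isometric_deformation (R : realType) (m n : nat) (p : vertices R)
    (eps : R) (P : R -> vertices R)
    (A : nat -> nat -> R -> 'M[R]_3) (b : nat -> nat -> R -> 'rV[R]_3) : Prop :=
  [/\ forall i j, (i <= m)%N -> (j <= n)%N -> P 0 i j = p i j,
      forall t, - eps < t < eps -> conjugate_net m n (P t)
    & forall i j, is_face m n i j ->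
        [/\ A i j 0 = 1%:M /\ b i j 0 = 0,
            forall k l, smooth_near0 eps (fun t => A i j t k l),
            forall l, smooth_near0 eps (fun t => b i j t 0 l)
          & forall t, - eps < t < eps ->
              [/\ A i j t *m (A i j t)^T = 1%:M, \det (A i j t) = 1
                & forall k, face (P t) i j k
                            = face p i j k *m A i j t + b i j t]]].

Definition trivial_deformation (R : realType) (m n : nat) (eps : R)
    (A : nat -> nat -> R -> 'M[R]_3) (b : nat -> nat -> R -> 'rV[R]_3) : Prop :=
  forall i j i' j' t, is_face m n i j -> is_face m n i' j' ->
    - eps < t < eps -> A i j t = A i' j' t /\ b i j t = b i' j' t.

Definition flexible (R : realType) (m n : nat) (p : vertices R) : Prop :=
  exists (eps : R) (P : R -> vertices R)
         (A : nat -> nat -> R -> 'M[R]_3) (b : nat -> nat -> R -> 'rV[R]_3),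
    [/\ 0 < eps, isometric_deformation m n p eps P A b
      & ~ trivial_deformation m n eps A b].

Definition drop_columns (R : realType) (c : nat) (p : vertices R) :
    vertices R :=
  fun i j => p i (c + j)%N.

(* Main.v *)
(* Since beta + gamma = pi, the edges p_{0,j} p_{1,j} (j = 1, 2, 3) are parallel,
   with common unit direction u, and so are the edges p_{1,j} p_{2,j}, with
   direction d, and the edges p_{2,j} p_{3,j}, with direction w.  A realization is
   thus given by u, d, w and the directions e_0, .., e_3 of the edges in row 1,
   subject to prescribed inner products; the edges in row 2 are the mirror images
   of the e_j in the plane orthogonal to d, and w is the mirror image of u.
   The inner products of e_0 with u and d are both - 1 / sqrt 2, which forces
   <u, d> >= 0; those of e_3 are 1 / sqrt 2 and - 1 / sqrt 2, which forces
   <u, d> <= 0.  The columns 1, 2, 3 alone can be flexed by decreasing the angle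
   between u and d from pi / 2, the columns 2, 3, 4 by increasing it, while in the
   whole net u and d stay orthogonal, which makes all the angles constant. *)
From mathcomp Require Import all_boot all_order all_algebra.
From mathcomp Require Import boolp classical_sets functions reals.
From mathcomp Require Import topology normedtype derive trigo realfun.
From mathcomp Require Import ring lra.
Require Import Defs.

Set Implicit Arguments.
Unset Strict Implicit.
Unset Printing Implicit Defensive.

Import Order.TTheory GRing.Theory Num.Theory.
Import numFieldNormedType.Exports.
Local Open Scope classical_set_scope.
Local Open Scope ring_scope.

(** * Inner and cross products *)

(** The inner product of u and d cannot be the parameter of the flexes. It is the squared norm of
    e_0 + (u + d) / sqrt 2, so e_0 leaves the plane of u and d like the square root of this inner
    product, which is not smooth at 0. The parameter t is instead the component of e_0 (for columns
    2, 3, 4: of e_3) orthogonal to that plane; then the inner product of u and d is t^2 / (1 - t^2),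
    respectively its opposite. Orthogonality of u and d puts e_0 and e_3 into their plane, but
    leaves e_1 and e_2 free up to reflection in it. The inner products alone therefore do not give
    rigidity: continuity has to exclude a jump to the mirror image. The side lengths are constrained
    only by the gluing. The prescribed angles make F_{2,2} and F_{2,3} isosceles trapezoids, and
    this relates their sides so that the net closes up for every choice of directions. Congruence to
    the given quadrilaterals then becomes a matter of inner products only. *)

Lemma dotpE2 (R : realType) (u v : 'rV[R]_2) :
  dotp u v = u 0 0 * v 0 0 + u 0 1 * v 0 1.
Proof.
rewrite /dotp !big_ord_recl big_ord0 addr0.
by congr (u 0 _ * v 0 _ + u 0 _ * v 0 _); apply/val_inj.
Qed.

Lemma dotpE3 (R : realType) (u v : 'rV[R]_3) :
  dotp u v = u 0 0 * v 0 0 + u 0 1 * v 0 1 + u 0 2 * v 0 2.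
Proof.
rewrite /dotp !big_ord_recl big_ord0 addr0 addrA.
by congr (u 0 _ * v 0 _ + u 0 _ * v 0 _ + u 0 _ * v 0 _); apply/val_inj.
Qed.

Lemma row2P (R : realType) (u v : 'rV[R]_2) :
  u 0 0 = v 0 0 -> u 0 1 = v 0 1 -> u = v.
Proof.
move=> h0 h1; apply/rowP => -[[|[|//]] i].
- by rewrite (_ : Ordinal i = 0) //; apply/val_inj.
- by rewrite (_ : Ordinal i = 1) //; apply/val_inj.
Qed.

Lemma row3P (R : realType) (u v : 'rV[R]_3) :
  u 0 0 = v 0 0 -> u 0 1 = v 0 1 -> u 0 2 = v 0 2 -> u = v.
Proof.
move=> h0 h1 h2; apply/rowP => -[[|[|[|//]]] i].
- by rewrite (_ : Ordinal i = 0) //; apply/val_inj.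
- by rewrite (_ : Ordinal i = 1) //; apply/val_inj.
- by rewrite (_ : Ordinal i = 2) //; apply/val_inj.
Qed.

Lemma crossE (R : realType) (u v : 'rV[R]_3) :
  [/\ cross u v 0 0 = u 0 1 * v 0 2 - u 0 2 * v 0 1,
      cross u v 0 1 = u 0 2 * v 0 0 - u 0 0 * v 0 2
    & cross u v 0 2 = u 0 0 * v 0 1 - u 0 1 * v 0 0].
Proof.
by split; rewrite mxE; congr (u 0 _ * v 0 _ - u 0 _ * v 0 _); apply/val_inj.
Qed.

Lemma dotp_mulmx (R : realType) n (u v : 'rV[R]_n) : dotp u v = (u *m v^T) 0 0.
Proof. by rewrite mxE; apply: eq_bigr => i _; rewrite mxE. Qed.

Lemma dotpC (R : realType) n (u v : 'rV[R]_n) : dotp u v = dotp v u.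
Proof. by apply: eq_bigr => i _; rewrite mulrC. Qed.

Lemma dotpDl (R : realType) n (u v w : 'rV[R]_n) :
  dotp (u + v) w = dotp u w + dotp v w.
Proof. by rewrite !dotp_mulmx mulmxDl mxE. Qed.

Lemma dotpZl (R : realType) n a (u w : 'rV[R]_n) :
  dotp (a *: u) w = a * dotp u w.
Proof. by rewrite !dotp_mulmx -scalemxAl mxE. Qed.

Lemma dotpNl (R : realType) n (u w : 'rV[R]_n) : dotp (- u) w = - dotp u w.
Proof. by rewrite -scaleN1r dotpZl mulN1r. Qed.

Lemma dotpDr (R : realType) n (u v w : 'rV[R]_n) :
  dotp u (v + w) = dotp u v + dotp u w.
Proof. by rewrite dotpC dotpDl !(dotpC u). Qed.

Lemma dotpZr (R : realType) n a (u w : 'rV[R]_n) :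
  dotp u (a *: w) = a * dotp u w.
Proof. by rewrite dotpC dotpZl (dotpC u). Qed.

Lemma dotpNr (R : realType) n (u w : 'rV[R]_n) : dotp u (- w) = - dotp u w.
Proof. by rewrite dotpC dotpNl (dotpC u). Qed.

Definition dotp_linear := (dotpDl, dotpDr, dotpNl, dotpNr, dotpZl, dotpZr).

Lemma dotp_ge0 (R : realType) n (u : 'rV[R]_n) : 0 <= dotp u u.
Proof. by apply: sumr_ge0 => i _; rewrite -expr2 sqr_ge0. Qed.

Lemma dotp_eq0 (R : realType) n (u : 'rV[R]_n) : dotp u u = 0 -> u = 0.
Proof.
move/eqP; rewrite psumr_eq0; last by move=> i _; rewrite -expr2 sqr_ge0.
move=> /allP h; apply/rowP => i; rewrite mxE.
have := h i; rewrite mem_index_enum => /(_ isT) /implyP /(_ isT).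
by rewrite mulf_eq0 orbb => /eqP.
Qed.

Lemma dotp_mulmx_orth (R : realType) m n (L : 'M[R]_(m, n)) (u v : 'rV_m) :
  L *m L^T = 1%:M -> dotp (u *m L) (v *m L) = dotp u v.
Proof.
by move=> h; rewrite !dotp_mulmx trmx_mul mulmxA -(mulmxA u) h mulmx1.
Qed.

Lemma edistC (R : realType) n (a b : 'rV[R]_n) : edist a b = edist b a.
Proof. by rewrite /edist /enorm -opprB dotpNl dotpNr opprK. Qed.

Lemma edist_gt0 (R : realType) n (a b : 'rV[R]_n) : a != b -> 0 < edist a b.
Proof.
move=> ab; rewrite sqrtr_gt0 lt0r dotp_ge0 andbT.
by apply: contra ab => /eqP /dotp_eq0 /eqP; rewrite subr_eq0 eq_sym.
Qed.

Lemma sqr_edist (R : realType) n (a b : 'rV[R]_n) :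
  (edist a b) ^+ 2 = dotp (b - a) (b - a).
Proof. by rewrite sqr_sqrtr ?dotp_ge0. Qed.

Definition orthonormal2 (R : realType) n (D M : 'rV[R]_n) : Prop :=
  [/\ dotp D D = 1, dotp M M = 1 & dotp D M = 0].

Lemma side_of_lineE (R : realType) (a b x : 'rV[R]_2) :
  side_of_line a b x =
  (b 0 0 - a 0 0) * (x 0 1 - a 0 1) - (b 0 1 - a 0 1) * (x 0 0 - a 0 0).
Proof.
rewrite /side_of_line (expand_det_row _ (lshift 1 0)) !big_ord_recl big_ord0.
rewrite /cofactor !det_mx11 !mxE /=.
case: splitP => j; rewrite ?ord1 //= => _.
case: splitP => k; rewrite ?ord1 //= => _.
rewrite !mxE /= expr0 expr1 addr0 mul1r mulN1r mulrN.
by congr ((b 0 _ - a 0 _) * (x 0 _ - a 0 _)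
  - (b 0 _ - a 0 _) * (x 0 _ - a 0 _)); apply/val_inj.
Qed.

(** * Planar quadrilaterals in space *)

Lemma ord4_shift (k l : 'I_4) : [\/ l = k, l = k + 1, l = k + 2 | l = k + 3].
Proof.
have -> : l = k + (l - k) by rewrite addrC subrK.
case: (l - k) => -[|[|[|[|//]]]] h.
- by apply: Or41; rewrite (_ : Ordinal h = 0) ?addr0 //; apply/val_inj.
- by apply: Or42; congr (_ + _); apply/val_inj.
- by apply: Or43; congr (_ + _); apply/val_inj.
- by apply: Or44; congr (_ + _); apply/val_inj.
Qed.

Lemma ord4_pred (k : 'I_4) : k - 1 = k + 3.
Proof. by congr (_ + _); apply/val_inj. Qed.

(* Since a strictly convex quadrilateral lies on one side of each of its
   sides, [m] can be chosen so that both angles at the side are measured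
   towards [m]. *)
Lemma strictly_convex_frame (R : realType) (q : quad R 2) (k : 'I_4) :
  strictly_convex q ->
  exists d m : 'rV[R]_2,
    [/\ orthonormal2 d m,
        forall x, x = dotp x d *: d + dotp x m *: m,
        0 < edist (q k) (q (k + 1)) /\ q (k + 1) = q k + edist (q k) (q (k + 1)) *: d,
        [/\ 0 < edist (q k) (q (k + 3)), 0 < sin (angle q k)
          & q (k + 3) = q k + edist (q k) (q (k + 3)) *:
              (cos (angle q k) *: d + sin (angle q k) *: m)]
      & [/\ 0 < edist (q (k + 1)) (q (k + 2)), 0 < sin (angle q (k + 1))
          & q (k + 2) = q (k + 1) + edist (q (k + 1)) (q (k + 2)) *:
              (- cos (angle q (k + 1)) *: d + sin (angle q (k + 1)) *: m)]].
Proof.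
move=> cvx.
pose s2 := side_of_line (q k) (q (k + 1)) (q (k + 2)).
pose s3 := side_of_line (q k) (q (k + 1)) (q (k + 3)).
have s23 : 0 < s2 * s3 := cvx k.
pose A := q k; pose B := q (k + 1); pose C := q (k + 2); pose D := q (k + 3).
have AB : A != B.
  apply/eqP => AB; move: s23; rewrite /s2 side_of_lineE -/A -/B AB !subrr.
  by rewrite !mul0r subrr mul0r ltxx.
have L0 := edist_gt0 AB; set L := edist A B in L0.
have s3n : s3 != 0 by apply: contraTneq s23 => ->; rewrite mulr0 ltxx.
pose sg : R := Num.sg s3.
have sg2 : sg * sg = 1 by rewrite -expr2 sqr_sg s3n.
have sg3 : 0 < sg * s3 by rewrite -normrEsg normr_gt0.
have sg3' : 0 < sg * s2.
  have : 0 < (sg * s2) * (sg * s3) by rewrite mulrACA sg2 mul1r.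
  by rewrite pmulr_lgt0.
pose d := L^-1 *: (B - A).
(* A quarter turn of [d], with the sign of [s3], so that the fourth vertex, and with it the third,
   has a positive coordinate along [m]. *)
pose m : 'rV[R]_2 := \row_j (if j == 0 then - sg * d 0 1 else sg * d 0 0).
have m0 : m 0 0 = - sg * d 0 1 by rewrite mxE.
have m1 : m 0 1 = sg * d 0 0 by rewrite mxE.
have Ld : B - A = L *: d by rewrite scalerA divff ?scale1r // gt_eqF.
have dd : dotp d d = 1.
  rewrite dotpZl dotpZr -sqr_edist -/L; field; exact: lt0r_neq0.
have ort : orthonormal2 d m.
  split=> //; rewrite dotpE2 m0 m1; last by ring.
  rewrite dotpE2 in dd.
  transitivity (sg * sg * (d 0 0 * d 0 0 + d 0 1 * d 0 1)); first ring.
  by rewrite dd sg2 mulr1.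
have dec x : x = dotp x d *: d + dotp x m *: m.
  rewrite dotpE2 in dd.
  have e (a b : R) (u v : 'rV[R]_2) i : (a *: u + b *: v) 0 i = a * u 0 i + b * v 0 i.
    by rewrite !mxE.
  apply: row2P; rewrite e !dotpE2 m0 m1.
    transitivity (x 0 0 * (d 0 0 * d 0 0 + sg * sg * (d 0 1 * d 0 1))
        + x 0 1 * (d 0 0 * d 0 1) * (1 - sg * sg)); last by ring.
    by rewrite sg2 mul1r dd subrr mulr0 addr0 mulr1.
  transitivity (x 0 1 * (sg * sg * (d 0 0 * d 0 0) + d 0 1 * d 0 1)
      + x 0 0 * (d 0 0 * d 0 1) * (1 - sg * sg)); last by ring.
  by rewrite sg2 mul1r dd subrr mulr0 addr0 mulr1.
have side x : dotp (x - A) m = sg * side_of_line A B x / L.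
  rewrite dotpE2 m0 m1 side_of_lineE.
  have e i : B 0 i - A 0 i = L * d 0 i.
    by have := congr1 (fun v : 'rV_2 => v 0 i) Ld; rewrite !mxE.
  by rewrite !e !mxE; field; exact: lt0r_neq0.
have sideB x : dotp (x - B) m = sg * side_of_line A B x / L.
  rewrite -side (_ : x - B = x - A - (B - A)); last first.
    by rewrite opprB addrA subrK.
  case: ort => _ _ dm.
  by rewrite [LHS]dotpDl dotpNl Ld dotpZl dm mulr0 subr0.
clearbody m d.
have norm2 (v : 'rV[R]_2) : dotp v v = dotp v d ^+ 2 + dotp v m ^+ 2.
  have e : dotp v v = dotp (dotp v d *: d + dotp v m *: m) v by rewrite -dec.
  by rewrite e !dotp_linear (dotpC d) (dotpC m) !expr2.
(* Polar coordinates in the upper half-plane, where [acos] recovers the angle. They are used with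
   [d] at the vertex [k] and with [- d] at [k + 1], from which the side points backwards. *)
have polar (v d' : 'rV[R]_2) (x := dotp v d' / enorm v) :
    dotp v v = dotp v d' ^+ 2 + dotp v m ^+ 2 -> 0 < dotp v m ->
    [/\ 0 < enorm v, 0 < sin (acos x), dotp v d' = enorm v * cos (acos x)
      & dotp v m = enorm v * sin (acos x)].
  move=> vv vm.
  have e2 : enorm v ^+ 2 = dotp v d' ^+ 2 + dotp v m ^+ 2.
    by rewrite sqr_sqrtr ?dotp_ge0.
  have e0 : 0 < enorm v.
    rewrite lt0r sqrtr_ge0 andbT; apply/eqP => h.
    by move: e2; rewrite h => e2; nra.
  have en0 := lt0r_neq0 e0.
  have sq : 1 - x ^+ 2 = (dotp v m / enorm v) ^+ 2.
    by rewrite !expr_div_n e2; field; rewrite -e2 expf_neq0.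
  have b : -1 <= x <= 1.
    have := sqr_ge0 (dotp v m / enorm v); rewrite -sq => h.
    by rewrite -ler_norml -(@expr_le1 _ 2) // real_normK ?num_real //; lra.
  have st : sin (acos x) = dotp v m / enorm v.
    by rewrite sin_acos // sq sqrtr_sqr gtr0_norm // divr_gt0.
  split; rewrite ?st ?divr_gt0 //; last by field.
  by rewrite acosK ?in_itv //= /x; field.
exists d, m; split=> //.
- by split; rewrite // -/A -/B -/L -Ld addrC subrK.
- have := polar (D - A) d (norm2 _); rewrite side -/s3 => /(_ (divr_gt0 sg3 L0)).
  have -> : dotp (D - A) d / enorm (D - A) =
      dotp (q (k - 1) - q k) (q (k + 1) - q k) /
      (edist (q k) (q (k - 1)) * edist (q k) (q (k + 1))).
    rewrite ord4_pred -/A -/B -/D -/L Ld dotpZr.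
    rewrite -/(edist A D) dotpC.
    by rewrite (mulrC (edist A D)) -mulf_div divff ?gt_eqF // mul1r dotpC.
  rewrite -/(angle q k) => -[e0 s0 ec es]; split=> //.
  rewrite -/D -/A /edist scalerDr !scalerA -ec -es -side -dec.
  by rewrite addrC subrK.
- have := polar (C - B) (- d).
  rewrite dotpNr sqrrN => /(_ (norm2 _)).
  rewrite sideB -/s2 => /(_ (divr_gt0 sg3' L0)).
  have -> : - dotp (C - B) d / enorm (C - B) =
      dotp (q (k + 1 - 1) - q (k + 1)) (q (k + 1 + 1) - q (k + 1)) /
      (edist (q (k + 1)) (q (k + 1 - 1)) * edist (q (k + 1)) (q (k + 1 + 1))).
    have -> : k + 1 + 1 = k + 2 by rewrite -addrA; congr (_ + _); apply/val_inj.
    rewrite addrK -/A -/B -/C (edistC B) -/L -(opprB B A) Ld.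
    by rewrite dotpNl dotpZl -mulrN -mulf_div divff ?gt_eqF // mul1r dotpC.
  rewrite -/(angle q (k + 1)) => -[e0 s0 ec es]; split=> //.
  rewrite -/C -/B /edist scalerDr !scalerA mulrN -ec -es -sideB opprK -dec.
  by rewrite addrC subrK.
Qed.

(** Three consecutive sides and the two angles between them determine a quadrilateral.
    Orthonormality of [D] and [M] is kept out, so that this is a vector identity which can be
    checked for arbitrary edge directions. *)
Definition placed (R : realType) (q : quad R 2) (q' : quad R 3) (k : 'I_4)
    (D M : 'rV[R]_3) : Prop :=
  [/\ q' (k + 1) = q' k + edist (q k) (q (k + 1)) *: D,
      q' (k + 3) = q' k + edist (q k) (q (k + 3)) *:
        (cos (angle q k) *: D + sin (angle q k) *: M)
    & q' (k + 2) = q' (k + 1) + edist (q (k + 1)) (q (k + 2)) *: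
        (- cos (angle q (k + 1)) *: D + sin (angle q (k + 1)) *: M)].

Definition isometric_image (R : realType) (q : quad R 2) (q' : quad R 3) :
    Prop :=
  exists (L : 'M[R]_(2, 3)) (c : 'rV[R]_3),
    L *m L^T = 1%:M /\ forall l, q' l = q l *m L + c.

(** The coordinates depend on [q] and [k] only, so a linear map that matches the frames of two
    placements also matches the placed quadrilaterals, up to a translation. *)
Lemma placed_coords (R : realType) (q : quad R 2) (k : 'I_4) :
  exists x y : 'I_4 -> R, forall q' D M, placed q q' k D M ->
    forall l, q' l = q' k + x l *: D + y l *: M.
Proof.
pose t := angle q k; pose t' := angle q (k + 1).
pose x l := if l == k then 0 else if l == k + 1 then edist (q k) (q (k + 1))
  else if l == k + 3 then edist (q k) (q (k + 3)) * cos t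
  else edist (q k) (q (k + 1)) - edist (q (k + 1)) (q (k + 2)) * cos t'.
pose y l := if l == k then 0 else if l == k + 1 then 0
  else if l == k + 3 then edist (q k) (q (k + 3)) * sin t
  else edist (q (k + 1)) (q (k + 2)) * sin t'.
have neq i j : (k + i == k + j) = (i == j) by rewrite (inj_eq (addrI k)).
have neq0 i : (k + i == k) = (i == 0) by rewrite -subr_eq0 addrAC subrr add0r.
exists x, y => q' D M [h1 h3 h2] l.
case: (ord4_shift k l) => ->; rewrite /x /y ?neq ?neq0 /= ?eqxx.
- by rewrite !scale0r !addr0.
- by rewrite scale0r addr0.
- rewrite h2 h1 -!addrA; congr (_ + _).
  by rewrite scalerDr !scalerA scalerBl addrA mulrN scaleNr.
- by rewrite h3 scalerDr !scalerA addrA.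
Qed.

Lemma mulmx_tr_dotp (R : realType) m n (x d : 'rV[R]_m) (D : 'rV[R]_n) :
  x *m d^T *m D = dotp x d *: D.
Proof. by rewrite (mx11_scalar (x *m d^T)) -dotp_mulmx mul_scalar_mx. Qed.

Lemma placed_image (R : realType) (q : quad R 2) (q' : quad R 3) (k : 'I_4)
    (D M : 'rV[R]_3) :
  strictly_convex q -> orthonormal2 D M -> placed q q' k D M ->
  isometric_image q q'.
Proof.
move=> cvx [DD MM DM] [h1 h3 h2].
have [d [m [[dd mm dm] dec [_ e1] [_ _ e3] [_ _ e2]]]] :=
  strictly_convex_frame k cvx.
(* The linear map that sends the plane frame [d], [m] to [D], [M]. *)
pose L := d^T *m D + m^T *m M.
have Lx x : x *m L = dotp x d *: D + dotp x m *: M.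
  by rewrite mulmxDr !mulmxA !mulmx_tr_dotp.
exists L, (q' k - q k *m L); split.
  apply/row_matrixP => i; rewrite !rowE mulmxA mulmx1 [RHS]dec.
  set x := delta_mx 0 i; rewrite Lx linearD /= !trmx_mul !trmxK mulmxDr.
  rewrite !mulmxA !mulmx_tr_dotp.
  by rewrite !dotp_linear (dotpC M) DD MM DM !mulr0 !mulr1 addr0 add0r.
move=> l; suff -> : q' l = q' k + (q l - q k) *m L.
  by rewrite mulmxBl addrCA addrC.
have LD : d *m L = D by rewrite Lx dd dm scale1r scale0r addr0.
have LM : m *m L = M by rewrite Lx (dotpC m) mm dm scale1r scale0r add0r.
have sub (a b : 'rV[R]_2) : a + b - a = b by rewrite addrC addKr.
have f1 : q (k + 1) - q k = edist (q k) (q (k + 1)) *: d.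
  by rewrite {1}e1 sub.
have f2 : q (k + 2) - q k = edist (q k) (q (k + 1)) *: d +
    edist (q (k + 1)) (q (k + 2)) *:
      (- cos (angle q (k + 1)) *: d + sin (angle q (k + 1)) *: m).
  by rewrite {1}e2 {1}e1 -(addrA (q k)) sub.
have f3 : q (k + 3) - q k = edist (q k) (q (k + 3)) *:
    (cos (angle q k) *: d + sin (angle q k) *: m).
  by rewrite {1}e3 sub.
case: (ord4_shift k l) => ->.
- by rewrite subrr mul0mx addr0.
- by rewrite h1 f1 -scalemxAl LD.
- rewrite h2 h1 f2 -addrA; congr (_ + _).
  by rewrite mulmxDl -!scalemxAl mulmxDl -!scalemxAl LD LM.
- by rewrite h3 f3 -scalemxAl mulmxDl -!scalemxAl LD LM.
Qed.

Lemma dotp_cross (R : realType) (u v : 'rV[R]_3) :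
  [/\ dotp (cross u v) u = 0, dotp (cross u v) v = 0
    & dotp (cross u v) (cross u v) = dotp u u * dotp v v - dotp u v ^+ 2].
Proof.
have [c0 c1 c2] := crossE u v.
by split; rewrite !dotpE3 c0 c1 c2; ring.
Qed.

Lemma image_congruent (R : realType) (q : quad R 2) (q' : quad R 3) :
  isometric_image q q' -> congruent q q'.
Proof.
move=> [L [c [LL e]]]; exists (fun x => x *m L + c); split=> // x y.
by rewrite /edist /enorm opprD addrACA subrr addr0 -mulmxBl dotp_mulmx_orth.
Qed.

Lemma image_coplanar (R : realType) (q : quad R 2) (q' : quad R 3) :
  isometric_image q q' -> coplanar q'.
Proof.
move=> [L [c [LL e]]].
pose a := row 0 L; pose b := row 1 L.
have Lij i j : dotp (row i L) (row j L) = (i == j)%:R.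
  have <- : (L *m L^T) i j = (i == j)%:R by rewrite LL mxE.
  by rewrite mxE; apply: eq_bigr => k _; rewrite !mxE.
have [va vb vv] := dotp_cross a b.
exists (cross a b), (dotp (cross a b) c); split.
  apply/eqP => v0; move: vv; rewrite !Lij v0 /=.
  rewrite dotpE3 !mxE; lra.
move=> k; rewrite e dotpDr -[RHS]add0r; congr (_ + _).
suff : cross a b *m L^T = 0.
  by move=> h; rewrite dotp_mulmx trmx_mul mulmxA h mul0mx mxE.
have ent i : (cross a b *m L^T) 0 i = dotp (cross a b) (row i L).
  by rewrite mxE; apply: eq_bigr => l _; rewrite !mxE.
by apply: row2P; rewrite ent mxE.
Qed.

(** The signed distance [g] from the line through a side is affine up to scaling; it vanishes on
    that side and has one strict sign at the other two vertices. Hence it has no zero on the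
    opposite side, and on the adjacent side only the common vertex. *)
Lemma strictly_convex_simple (R : realType) (q : quad R 2) :
  strictly_convex q -> simple_quad q.
Proof.
move=> cvx k.
pose g := side_of_line (q k) (q (k + 1)).
have gseg s a b : g ((1 - s) *: a + s *: b) = (1 - s) * g a + s * g b.
  by rewrite /g !side_of_lineE !mxE; ring.
have g0 : g (q k) = 0 by rewrite /g side_of_lineE; ring.
have g1 : g (q (k + 1)) = 0 by rewrite /g side_of_lineE; ring.
have g23 : 0 < g (q (k + 2)) * g (q (k + 3)) := cvx k.
split; apply/seteqP; split=> x /=.
- move=> [[s hs ->] [s' hs' e]]; have := congr1 g e.
  rewrite !gseg g0 g1 !mulr0 !addr0 add0r => /esym/eqP.
  rewrite mulf_eq0 => /orP[/eqP s0|/eqP z].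
    by rewrite e s0 subr0 scale1r scale0r addr0.
  by move: g23; rewrite z mul0r ltxx.
- move=> ->; split.
    by exists 1; rewrite ?ler01 ?lexx // subrr scale0r scale1r add0r.
  by exists 0; rewrite ?ler01 ?lexx // subr0 scale0r scale1r addr0.
- move=> [[s hs ->] [s' /andP[h0 h1] e]]; have := congr1 g e.
  rewrite !gseg g0 g1 !mulr0 !addr0 => h.
  have g2 : 0 < g (q (k + 2)) ^+ 2.
    by rewrite exprn_even_gt0 //=; apply: contraTneq g23 => ->; rewrite mul0r ltxx.
  have e2 : 0 = (1 - s') * g (q (k + 2)) ^+ 2
                + s' * (g (q (k + 2)) * g (q (k + 3))).
    rewrite -(mulr0 (g (q (k + 2)))) h; ring.
  have [s0|s0] := eqVneq s' 0; first by rewrite s0 in e2; lra.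
  have : 0 < s' * (g (q (k + 2)) * g (q (k + 3))).
    by rewrite mulr_gt0 // lt0r s0.
  have : 0 <= (1 - s') * g (q (k + 2)) ^+ 2.
    by rewrite mulr_ge0 ?subr_ge0 // ltW.
  lra.
- by [].
Qed.

Lemma image_simple (R : realType) (q : quad R 2) (q' : quad R 3) :
  isometric_image q q' -> simple_quad q -> simple_quad q'.
Proof.
move=> [L [c [LL e]]] simp k.
pose f (x : 'rV[R]_2) := x *m L + c.
have finj : injective f.
  by move=> x y /addIr /(congr1 (mulmx^~ L^T)); rewrite -!mulmxA LL !mulmx1.
have fseg a b x : segment (f a) (f b) x -> exists2 y, segment a b y & x = f y.
  move=> [s hs ->]; exists ((1 - s) *: a + s *: b); first by exists s.
  rewrite /f mulmxDl -!scalemxAl !scalerDr addrACA -[(1 - s) *: c + _]scalerDl.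
  by rewrite subrK scale1r.
have segf a b y : segment a b y -> segment (f a) (f b) (f y).
  move=> [s hs ->]; exists s => //.
  rewrite /f mulmxDl -!scalemxAl !scalerDr addrACA -[(1 - s) *: c + _]scalerDl.
  by rewrite subrK scale1r.
have [s1 s2] := simp k.
rewrite !e; split; apply/seteqP; split=> x //=.
- move=> [/fseg[y y1 ->] /fseg[z z1 /finj yz]]; subst z.
  have : [set q (k + 1)] y by rewrite -s1; split.
  by move=> ->.
- move=> ->; have : [set q (k + 1)] (q (k + 1)) by [].
  by rewrite -s1 => -[a1 a2]; split; apply: segf.
- move=> [/fseg[y y1 ->] /fseg[z z1 /finj yz]]; subst z.
  have : set0 y by rewrite -s2; split.
  by [].
Qed.

(** By convexity a single vertex off the line through a side decides in which half-plane the
    quadrilateral lies. Here [m] is such a vertex, and [t > 0] says that [y] points to its side;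
    only the component of [y] orthogonal to the side matters. *)
Lemma strictly_convex_half_plane (R : realType) (q : quad R 2) (q' : quad R 3)
    (k m : 'I_4) (D y : 'rV[R]_3) (e s t : R) :
  m = k + 2 \/ m = k + 3 -> strictly_convex q -> isometric_image q q' ->
  dotp D D = 1 -> 0 < e ->
  q' (k + 1) = q' k + e *: D -> 0 < t -> q' m = q' k + (s *: D + t *: y) ->
  forall l, half_plane (q' k) D (y - dotp D y *: D) (q' l).
Proof.
move=> mk cvx [L [c [LL im]]] DD e0 h1 t0 hm l.
have [d [n [[dd nn dn] _ [l1 e1] [l3 s3 e3] [l2 s2 e2]]]] :=
  strictly_convex_frame k cvx.
set a1 := edist (q k) (q (k + 1)) in l1 e1.
set a3 := edist (q k) (q (k + 3)) in l3 e3.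
set a2 := edist (q (k + 1)) (q (k + 2)) in l2 e2.
have step i x z : q i = q k + (x *: d + z *: n) ->
    q' i = q' k + (x *: (d *m L) + z *: (n *m L)).
  by move=> h; rewrite !im h mulmxDl mulmxDl -!scalemxAl addrAC.
set M := n *m L in step; set d' := d *m L in step.
have d'd' : dotp d' d' = 1 by rewrite dotp_mulmx_orth.
have f1 : q' (k + 1) = q' k + a1 *: d'.
  by rewrite (step (k + 1) a1 0) ?scale0r ?addr0.
have dD : d' = D.
  have h : a1 *: d' = e *: D by apply: (addrI (q' k)); rewrite -h1 f1.
  have : a1 ^+ 2 = e ^+ 2.
    by have := congr1 (fun v => dotp v v) h; rewrite !dotp_linear d'd' DD !mulr1 -!expr2.
  move=> /eqP; rewrite eqrXn2 ?ltW // => /eqP ae.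
  by rewrite -[LHS](scalerK (lt0r_neq0 l1)) h ae scalerK ?lt0r_neq0.
rewrite {}dD {d'd'} in step f1.
have DM : dotp D M = 0.
  have <- : d *m L = D.
    apply: (scalerI (lt0r_neq0 l1)); apply: (addrI (q' k)).
    by rewrite -f1 !im e1 mulmxDl -scalemxAl addrAC.
  by rewrite dotp_mulmx_orth.
have [x2 [z2 [z20 f2]]] : exists x2 z2, 0 < z2 /\ q' (k + 2) = q' k + (x2 *: D + z2 *: M).
  exists (a1 - a2 * cos (angle q (k + 1))), (a2 * sin (angle q (k + 1))).
  split; first by rewrite mulr_gt0.
  apply: step; rewrite e2 e1 -addrA; congr (_ + _).
  by rewrite scalerBl scalerDr !scalerA mulrN scaleNr !addrA.
have [x3 [z3 [z30 f3]]] : exists x3 z3, 0 < z3 /\ q' (k + 3) = q' k + (x3 *: D + z3 *: M).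
  exists (a3 * cos (angle q k)), (a3 * sin (angle q k)).
  split; first by rewrite mulr_gt0.
  by apply: step; rewrite e3 scalerDr !scalerA.
have {mk} [xm [zm [zm0 fm]]] : exists x z, 0 < z /\ q' m = q' k + (x *: D + z *: M).
  by case: mk => ->; [exists x2, z2|exists x3, z3].
have hM : zm *: M = t *: (y - dotp D y *: D).
  have h : xm *: D + zm *: M = s *: D + t *: y.
    by apply: (addrI (q' k)); rewrite -hm fm.
  have := congr1 (dotp D) h; rewrite !dotp_linear DM DD mulr0 addr0 !mulr1 => hs.
  move: h; rewrite hs scalerDl -addrA => /addrI h.
  by rewrite scalerBr -h scalerA [X in X - _]addrC addrK.
have {hM} -> : y - dotp D y *: D = (zm / t) *: M.
  by rewrite mulrC -scalerA hM scalerK ?lt0r_neq0.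
have hp x z : 0 <= z -> half_plane (q' k) D ((zm / t) *: M)
    (q' k + (x *: D + z *: M)).
  move=> hz; exists x, (z / (zm / t)); split.
    by rewrite divr_ge0 // ltW // divr_gt0.
  by rewrite scalerA divfK ?addrA // mulf_neq0 // ?invr_neq0 // lt0r_neq0.
case: (ord4_shift k l) => ->.
- by have := hp 0 0 (lexx _); rewrite !scale0r !addr0.
- by have := hp a1 0 (lexx _); rewrite scale0r addr0 f1.
- by rewrite f2; apply: hp; exact: ltW.
- by rewrite f3; apply: hp; exact: ltW.
Qed.

(** Equal angles at the base and supplementary ones opposite to it make the opposite side parallel
    to the base. The lengths come from writing the cosines at the two far vertices in the frame of
    the base. *)
Lemma isosceles_trapezoid (R : realType) (q : quad R 2) (k : 'I_4) :
  strictly_convex q ->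
  angle q (k + 1) = angle q k -> angle q (k + 3) = angle q (k + 2) ->
  cos (angle q (k + 2)) = - cos (angle q k) -> cos (angle q k) != 0 ->
  edist (q k) (q (k + 3)) = edist (q (k + 1)) (q (k + 2)) /\
  edist (q (k + 3)) (q (k + 2)) = edist (q k) (q (k + 1))
    - 2 * (edist (q k) (q (k + 3)) * cos (angle q k)).
Proof.
move=> cvx ee ee' cc c0.
have [d [m [[dd mm dm] _ [l1 e1] [l3 s3 e3] [l2 s2 e2]]]] :=
  strictly_convex_frame k cvx.
have cosa (i : 'I_4) :
    edist (q i) (q (i + 3)) * edist (q i) (q (i + 1)) * cos (angle q i)
    = dotp (q (i + 3) - q i) (q (i + 1) - q i).
  have [d' [m' [[dd' mm' dm'] _ [l1' e1'] [l3' s3' e3'] _]]] :=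
    strictly_convex_frame i cvx.
  have sub (a b : 'rV[R]_2) : a + b - a = b by rewrite addrC addKr.
  have -> : q (i + 3) - q i = edist (q i) (q (i + 3)) *:
      (cos (angle q i) *: d' + sin (angle q i) *: m').
    by rewrite {1}e3' sub.
  have -> : q (i + 1) - q i = edist (q i) (q (i + 1)) *: d' by rewrite {1}e1' sub.
  rewrite !dotp_linear dd' (dotpC m') dm'; ring.
set t := angle q k in ee cc c0 s3 e3 *.
rewrite ee in s2 e2.
set a1 := edist (q k) (q (k + 1)) in l1 e1 *.
set a3 := edist (q k) (q (k + 3)) in l3 e3 *.
set a2 := edist (q (k + 1)) (q (k + 2)) in l2 e2 *.
have := cosa (k + 2); have := cosa (k + 3).
have -> : k + 3 + 3 = k + 2 by rewrite -addrA; congr (_ + _); apply/val_inj.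
have -> : k + 3 + 1 = k by rewrite -addrA -[RHS]addr0; congr (_ + _); apply/val_inj.
have -> : k + 2 + 3 = k + 1 by rewrite -addrA; congr (_ + _); apply/val_inj.
have -> : k + 2 + 1 = k + 3 by rewrite -addrA; congr (_ + _); apply/val_inj.
rewrite ee' cc !(edistC (q (k + 2))) !(edistC _ (q k)) -/a3 -/a2.
set b := edist (q (k + 3)) (q (k + 2)).
(* The components of the fourth side along the base and orthogonal to it. The two cosine equations
   give [Y = 0], then [b = X], where the nonzero cosine settles the sign that [b ^+ 2 = X ^+ 2]
   leaves open. *)
pose X := a1 - (a2 + a3) * cos t; pose Y := (a2 - a3) * sin t.
have eb : q (k + 2) - q (k + 3) = X *: d + Y *: m.
  rewrite e2 e1 e3; apply/rowP => i; rewrite !mxE /X /Y; ring.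
rewrite -(opprB (q (k + 2)) (q (k + 3))) eb.
have -> : q k - q (k + 3) = - (a3 *: (cos t *: d + sin t *: m)).
  by rewrite e3 opprD addrA subrr add0r.
have -> : q (k + 1) - q (k + 2) = - (a2 *: (- cos t *: d + sin t *: m)).
  by rewrite e2 opprD addrA subrr add0r.
have b2 : b ^+ 2 = X ^+ 2 + Y ^+ 2.
  by rewrite sqr_edist eb !dotp_linear dd mm (dotpC m) dm; ring.
have b0 : 0 <= b by rewrite sqrtr_ge0.
rewrite !dotp_linear dd mm (dotpC m) dm => h1 h2.
have {}h1 : b * - cos t = - (X * cos t + Y * sin t).
  apply: (mulfI (lt0r_neq0 l3)); rewrite mulrA (mulrC a3) h1; ring.
have {}h2 : b * - cos t = - X * cos t + Y * sin t.
  apply: (mulfI (lt0r_neq0 l2)); rewrite mulrA h2; ring.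
have Ys : Y * sin t = 0 by lra.
have Y0 : Y = 0 by move/eqP: Ys; rewrite mulf_eq0 (gt_eqF s3) orbF => /eqP.
have a23 : a2 = a3.
  by apply/eqP; rewrite -subr_eq0; move/eqP: Y0; rewrite mulf_eq0 (gt_eqF s3) orbF.
split=> //.
have : b * cos t = X * cos t by lra.
by move/(mulIf c0) => ->; rewrite /X a23; ring.
Qed.

(** * Rotations *)

Definition rows3 (R : realType) (u v w : 'rV[R]_3) : 'M[R]_3 :=
  \matrix_(i, j) (tnth [tuple u; v; w] i) 0 j.

Lemma row_rows3 (R : realType) (u v w : 'rV[R]_3) i :
  row i (rows3 u v w) = tnth [tuple u; v; w] i.
Proof. by apply/rowP => j; rewrite !mxE. Qed.

Lemma rows3_mulmx (R : realType) (u v w : 'rV[R]_3) (A : 'M_3) :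
  rows3 u v w *m A = rows3 (u *m A) (v *m A) (w *m A).
Proof.
apply/row_matrixP => i; rewrite row_mul !row_rows3.
by case: i => -[|[|[|//]]] h; rewrite !(tnth_nth 0).
Qed.

Lemma det_mx3 (R : comRingType) (A : 'M[R]_3) :
  \det A = A 0 0 * (A 1 1 * A 2 2 - A 1 2 * A 2 1)
         - A 0 1 * (A 1 0 * A 2 2 - A 1 2 * A 2 0)
         + A 0 2 * (A 1 0 * A 2 1 - A 1 1 * A 2 0).
Proof.
rewrite (expand_det_row _ 0) !big_ord_recl big_ord0 /cofactor.
rewrite !(expand_det_row _ 0) !big_ord_recl !big_ord0 /cofactor !det_mx11 !mxE.
rewrite (_ : ord0 = 0) //.
do ! [rewrite (_ : lift _ _ = 0); last by apply/val_inj
     |rewrite (_ : lift _ _ = 1); last by apply/val_inj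
     |rewrite (_ : lift _ _ = 2); last by apply/val_inj].
rewrite /= ; ring.
Qed.

Lemma det_rows3 (R : realType) (u v w : 'rV[R]_3) :
  \det (rows3 u v w) = dotp (cross u v) w.
Proof.
have [c0 c1 c2] := crossE u v.
by rewrite det_mx3 dotpE3 c0 c1 c2 !mxE !(tnth_nth 0) /=; ring.
Qed.

Definition rotation_mx (R : realType) (A : 'M[R]_3) : Prop :=
  A *m A^T = 1%:M /\ \det A = 1.

(** Triple products are determinants, which a rotation preserves; pairing both sides with the
    difference [X] shows that [X] has norm zero. *)
Lemma cross_mulmx (R : realType) (u v : 'rV[R]_3) (A : 'M_3) :
  rotation_mx A -> cross (u *m A) (v *m A) = cross u v *m A.
Proof.
move=> [AA dA]; apply/eqP; rewrite -subr_eq0; apply/eqP.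
set X := _ - _; apply: dotp_eq0.
have XA : X = X *m A^T *m A by rewrite -mulmxA (mulmx1C AA) mulmx1.
rewrite {2}XA {1}/X dotpDl dotpNl dotp_mulmx_orth //.
by rewrite -!det_rows3 -rows3_mulmx det_mulmx dA mulr1 subrr.
Qed.

(** Two rotations that agree on [x] and [y] also agree on their cross product, hence on a basis. *)
Lemma rotation_mx_eq (R : realType) (A B : 'M[R]_3) (x y : 'rV_3) :
  rotation_mx A -> rotation_mx B -> cross x y != 0 ->
  x *m A = x *m B -> y *m A = y *m B -> A = B.
Proof.
move=> rA rB c0 hx hy.
have FU : rows3 x y (cross x y) \in unitmx.
  rewrite unitmxE det_rows3 unitfE; apply: contra c0 => /eqP.
  by move/dotp_eq0 => ->.
apply: (can_inj (mulKmx FU)); rewrite !rows3_mulmx hx hy.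
by rewrite -!cross_mulmx // hx hy.
Qed.

Lemma rows3_rotation (R : realType) (D M : 'rV[R]_3) :
  orthonormal2 D M -> rotation_mx (rows3 D M (cross D M)).
Proof.
move=> [DD MM DM]; have [cD cM cc] := dotp_cross D M.
have {}cc : dotp (cross D M) (cross D M) = 1.
  by rewrite cc DD MM DM; ring.
split; last by rewrite det_rows3.
apply/matrixP => i j; rewrite mxE.
transitivity (dotp (row i (rows3 D M (cross D M))) (row j (rows3 D M (cross D M)))).
  by apply: eq_bigr => k _; rewrite !mxE.
rewrite !row_rows3 !mxE !(tnth_nth 0).
case: i j => -[|[|[|//]]] i [] [|[|[|//]]] j //=.
- by rewrite dotpC.
- by rewrite dotpC.
- by rewrite dotpC.
Qed.

(** Vectors are rows and act from the left, and the transpose of the first frame is its inverse. *)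
Definition frame_rotation (R : realType) (D M D' M' : 'rV[R]_3) : 'M[R]_3 :=
  (rows3 D M (cross D M))^T *m rows3 D' M' (cross D' M').

Lemma frame_rotationP (R : realType) (D M D' M' : 'rV[R]_3) :
  orthonormal2 D M -> orthonormal2 D' M' ->
  [/\ rotation_mx (frame_rotation D M D' M'),
      D *m frame_rotation D M D' M' = D'
    & M *m frame_rotation D M D' M' = M'].
Proof.
move=> /rows3_rotation [F1 dF] /rows3_rotation [F1' dF'].
have rowsE : rows3 D M (cross D M) *m frame_rotation D M D' M' = rows3 D' M' (cross D' M').
  by rewrite mulmxA F1 mul1mx.
split.
- split; last by rewrite det_mulmx det_tr dF dF' mulr1.
  rewrite trmx_mul trmxK mulmxA -(mulmxA _ _ (_^T)) F1' mulmx1.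
  exact: mulmx1C.
- have := congr1 (row 0) rowsE; rewrite row_mul !row_rows3 !(tnth_nth 0).
  by [].
- have := congr1 (row 1) rowsE; rewrite row_mul !row_rows3 !(tnth_nth 0).
  by [].
Qed.

Lemma frame_rotation_id (R : realType) (D M : 'rV[R]_3) :
  orthonormal2 D M -> frame_rotation D M D M = 1%:M.
Proof. by move=> /rows3_rotation [/mulmx1C]. Qed.

(** * Smooth functions *)

(** The derivative is an explicit witness that has to be correct only on the interval. Closure under
    products, inverses and square roots is then an induction on the order, without formulas for
    iterated derivatives. *)
Fixpoint cont_diff (R : realType) (eps : R) (n : nat) (f : R -> R) : Prop :=
  if n is n'.+1 then
    exists2 g, forall t, - eps < t < eps -> is_derive t 1 f (g t)
             & cont_diff eps n' g
  else True.

Definition smooth_on (R : realType) (eps : R) (f : R -> R) : Prop :=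
  forall n, cont_diff eps n f.

Lemma cont_diffW (R : realType) (eps : R) n (f : R -> R) :
  cont_diff eps n.+1 f -> cont_diff eps n f.
Proof.
elim: n f => [//|n ih] f [g fg gn]; exists g => //.
exact: ih.
Qed.

Lemma cont_diff_ext (R : realType) (eps : R) n (f g : R -> R) :
  (forall t, f t = g t) -> cont_diff eps n f -> cont_diff eps n g.
Proof. by move=> /funext ->. Qed.

Lemma cont_diff_cst (R : realType) (eps : R) n (c : R) : cont_diff eps n (fun=> c).
Proof.
elim: n c => [//|n ih] c; exists (fun=> 0) => // t _.
exact: is_derive_cst.
Qed.

Lemma cont_diff_id (R : realType) (eps : R) n : cont_diff eps n id.
Proof.
case: n => [//|n]; exists (fun=> 1); last exact: cont_diff_cst.
by move=> t _; apply: is_derive_id.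
Qed.

Lemma cont_diffD (R : realType) (eps : R) n (f g : R -> R) :
  cont_diff eps n f -> cont_diff eps n g -> cont_diff eps n (f \+ g).
Proof.
elim: n f g => [//|n ih] f g [f' hf f'n] [g' hg g'n].
exists (f' \+ g'); last exact: ih.
by move=> t ht; apply: is_deriveD; [exact: hf|exact: hg].
Qed.

Lemma cont_diffM (R : realType) (eps : R) n (f g : R -> R) :
  cont_diff eps n f -> cont_diff eps n g -> cont_diff eps n (f \* g).
Proof.
elim: n f g => [//|n ih] f g cf cg.
have [f' hf f'n] := cf; have [g' hg g'n] := cg.
exists ((f \* g') \+ (g \* f')).
  move=> t ht; have := is_deriveM (hf t ht) (hg t ht).
  by [].
by apply: cont_diffD; apply: ih => //; apply: cont_diffW.
Qed.

(** The derivative of the inverse contains the inverse again, but at one order less, where the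
    induction hypothesis applies. The square root below works in the same way. *)
Lemma cont_diffV (R : realType) (eps : R) n (f : R -> R) :
  (forall t, - eps < t < eps -> f t != 0) ->
  cont_diff eps n f -> cont_diff eps n (fun t => (f t)^-1).
Proof.
move=> f0; elim: n => [//|n ih] cf; have [f' hf f'n] := cf.
exists (fun t => (- 1 * (((f t)^-1 * (f t)^-1) * f' t))).
  move=> t ht; apply: is_derive_eq (is_deriveV (f0 t ht) (hf t ht)) _.
  change (- (f t) ^- 2 * f' t = - 1 * (((f t)^-1 * (f t)^-1) * f' t)).
  by rewrite -exprVn expr2 mulN1r mulNr.
have cV := ih (cont_diffW cf).
apply: (cont_diffM (cont_diff_cst _ _ _)).
by apply: cont_diffM => //; apply: cont_diffM.
Qed.

Lemma cont_diff_sqrt (R : realType) (eps : R) n (f : R -> R) :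
  (forall t, - eps < t < eps -> 0 < f t) ->
  cont_diff eps n f -> cont_diff eps n (fun t => Num.sqrt (f t)).
Proof.
move=> f0; elim: n => [//|n ih] cf; have [f' hf f'n] := cf.
exists (fun t => 2^-1 * ((Num.sqrt (f t))^-1 * f' t)).
  move=> t ht; have h1 := is_derive1_sqrt (f0 t ht).
  have h := @is_derive1_comp _ _ _ _ _ _ h1 (hf t ht).
  by rewrite mulrA -invfM; exact: h.
apply: (cont_diffM (cont_diff_cst _ _ _)).
apply: cont_diffM => //; apply: cont_diffV; last exact/ih/cont_diffW.
by move=> t ht; rewrite gt_eqF // sqrtr_gt0 f0.
Qed.

Lemma smooth_on_near0 (R : realType) (eps : R) (f : R -> R) :
  smooth_on eps f -> smooth_near0 eps f.
Proof.
move=> sf k t ht.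
have nearI s : - eps < s < eps -> \forall x \near s, - eps < x < eps.
  by move=> hs; have := @near_in_itvoo R (- eps) eps s; rewrite in_itv /=; apply.
(* The library derivative agrees with the witness only on the interval, so the induction has to
   allow for functions that coincide only there. One extra order makes the [n]-th derivative itself
   derivable. *)
suff main : forall n (g h : R -> R), (forall s, - eps < s < eps -> h s = g s) ->
    cont_diff eps n.+1 g -> forall s, - eps < s < eps -> derivable (derive1n n h) s 1.
  exact: main (sf k.+1) _ ht.
elim=> [|n ih] g h gh cg s hs.
  have [g' hg' _] := cg.
  apply: near_eq_derivable (_ : derivable g s 1); last by case: (hg' s hs).
  by apply: filterS (nearI s hs) => x hx; exact/esym/gh.
have [g' hg' cg'] := cg.
rewrite derive1Sn; apply: (ih g') => // x hx.
rewrite derive1E; have [_ <-] := hg' x hx.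
by apply: near_eq_derive; apply: filterS (nearI x hx) => z hz; exact: gh.
Qed.

(** * The net determined by the edge directions *)

Definition half_sqrt2 (R : realType) : R := Num.sqrt 2^-1.
Definition half_sqrt3 (R : realType) : R := Num.sqrt (3 / 4).
Arguments half_sqrt2 {R}.
Arguments half_sqrt3 {R}.

Lemma half_sqrt2_gt0 (R : realType) : 0 < half_sqrt2 :> R.
Proof. by rewrite sqrtr_gt0 invr_gt0. Qed.

Lemma half_sqrt3_gt0 (R : realType) : 0 < half_sqrt3 :> R.
Proof. by rewrite sqrtr_gt0 divr_gt0. Qed.

Lemma sqr_half_sqrt2 (R : realType) : half_sqrt2 ^+ 2 = 2^-1 :> R.
Proof. by rewrite sqr_sqrtr // invr_ge0. Qed.

Lemma sqr_half_sqrt3 (R : realType) : half_sqrt3 ^+ 2 = 3 / 4 :> R.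
Proof. by rewrite sqr_sqrtr // divr_ge0. Qed.

Lemma half_sqrt2V (R : realType) : half_sqrt2^-1 = 2 * half_sqrt2 :> R.
Proof.
have r0 := lt0r_neq0 (half_sqrt2_gt0 R).
by apply: (mulfI r0); rewrite mulfV // mulrCA -expr2 sqr_half_sqrt2; field.
Qed.

Lemma cos_pi4 (R : realType) : cos (pi / 4) = half_sqrt2 :> R.
Proof.
have p0 := pi_gt0 R.
have c0 : 0 < cos (pi / 4 : R) by apply: cos_gt0_pihalf; lra.
apply/eqP; rewrite -(@eqrXn2 _ 2) ?sqrtr_ge0 ?(ltW c0) // sqr_half_sqrt2.
apply/eqP; have := cos_mulr2n (pi / 4 : R).
have -> : pi / 4 *+ 2 = pi / 2 :> R by rewrite mulr2n; field.
by rewrite cos_pihalf => h; lra.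
Qed.

Lemma sin_pi4 (R : realType) : sin (pi / 4) = half_sqrt2 :> R.
Proof.
by rewrite -cos_pi4 -cosBpihalf -cosN; congr cos; field.
Qed.

Lemma cos_pi3 (R : realType) : cos (pi / 3) = 2^-1 :> R.
Proof.
have p0 := pi_gt0 R.
have c0 : 0 < cos (pi / 3 : R) by apply: cos_gt0_pihalf; lra.
have := cos_mulr2n (pi / 3 : R).
have -> : pi / 3 *+ 2 = - (pi / 3) + pi :> R by rewrite mulr2n; field.
rewrite cosDpi cosN; set c := cos _ in c0 *; rewrite mulr2n => h.
have : (c + 1) * (c - 2^-1) = 0 by rewrite expr2 in h; lra.
by move/eqP; rewrite mulf_eq0 => /orP[] /eqP; lra.
Qed.

Lemma sin_pi3 (R : realType) : sin (pi / 3) = half_sqrt3 :> R.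
Proof.
have p0 := pi_gt0 R.
have s0 : 0 < sin (pi / 3 : R) by apply: sin_gt0_pi; lra.
apply/eqP; rewrite -(@eqrXn2 _ 2) ?sqrtr_ge0 ?(ltW s0) // sqr_half_sqrt3.
by apply/eqP; have := cos2Dsin2 (pi / 3 : R); rewrite cos_pi3 => h; lra.
Qed.

Lemma cos_2pi3 (R : realType) : cos (2 * pi / 3) = - 2^-1 :> R.
Proof.
have -> : 2 * pi / 3 = - (pi / 3) + pi :> R by field.
by rewrite cosDpi cosN cos_pi3.
Qed.

Lemma sin_2pi3 (R : realType) : sin (2 * pi / 3) = half_sqrt3 :> R.
Proof.
have -> : 2 * pi / 3 = - (pi / 3) + pi :> R by field.
by rewrite sinDpi sinN opprK sin_pi3.
Qed.

Lemma cos_3pi4 (R : realType) : cos (2 * (pi / 4) + pi / 4) = - half_sqrt2 :> R.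
Proof.
have -> : 2 * (pi / 4) + pi / 4 = - (pi / 4) + pi :> R by field.
by rewrite cosDpi cosN cos_pi4.
Qed.

Lemma sin_3pi4 (R : realType) : sin (2 * (pi / 4) + pi / 4) = half_sqrt2 :> R.
Proof.
have -> : 2 * (pi / 4) + pi / 4 = - (pi / 4) + pi :> R by field.
by rewrite sinDpi sinN opprK sin_pi4.
Qed.

(* [dir_e V j] is the direction from p_{1,j} to p_{1,j+1}, [edge2 V j] the one from
   p_{2,j} to p_{2,j+1}. *)
Record directions (R : realType) := Directions {
  dir_u : 'rV[R]_3; dir_d : 'rV[R]_3; dir_w : 'rV[R]_3;
  dir_e : nat -> 'rV[R]_3 }.

(** The coefficient is minus twice the prescribed inner product of [dir_e V j] and [dir_d V], so
    this is the reflected edge once the inner products are right. With constant coefficients it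
    stays linear in the directions. *)
Definition edge2 (R : realType) (V : directions R) (j : nat) : 'rV[R]_3 :=
  dir_e V j
  + (match j with 1 => 1 | 2 => -1 | _ => half_sqrt2^-1 end) *: dir_d V.

Definition hlen (R : realType) (Q : nat -> nat -> quad R 2) i j : R :=
  edist (Q i j bottom_left) (Q i j bottom_right).

Definition vlen (R : realType) (Q : nat -> nat -> quad R 2) i j : R :=
  edist (Q i j top_right) (Q i j bottom_right).

(* The face F_{i,j} is laid out from its side joining the vertices [frame_base] and
   [frame_base + 1], along which [frame_D] points; that side is chosen so that the
   vectors spanning the face have constant inner products.  [frame_y] is the
   direction of an adjacent side, at angle with cosine [frame_cos] and sine
   [frame_sin] to [frame_D], and [frame_M] completes [frame_D] to an orthonormal
   basis of the plane of the face. *)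
Definition frame_base (i j : nat) : 'I_4 :=
  match i, j with
  | 1, _ => bottom_right
  | 2, 1 | 2, 3 => top_right
  | 2, _ => bottom_left
  | _, _ => top_left
  end.

Definition frame_D (R : realType) (V : directions R) (i j : nat) : 'rV[R]_3 :=
  match i with
  | 1 => - dir_e V j.-1
  | 2 => if odd j then dir_d V else - dir_d V
  | _ => edge2 V j.-1
  end.

Definition frame_y (R : realType) (V : directions R) (i j : nat) : 'rV[R]_3 :=
  match i, j with
  | 1, _ => dir_u V
  | 2, 1 => - dir_e V 0
  | 2, 2 => dir_e V 1
  | 2, 3 => - dir_e V 2
  | 2, _ => dir_e V 3
  | _, _ => dir_w V
  end.

Definition frame_cos (R : realType) (i j : nat) : R :=
  match i, j with
  | 1, 1 | 2, 1 | 2, 4 | 3, 4 => half_sqrt2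
  | 1, 4 | 3, 1 => - half_sqrt2
  | 1, 2 | 2, 2 | 3, 3 => 2^-1
  | _, _ => - 2^-1
  end.

Definition frame_sin (R : realType) (j : nat) : R :=
  match j with 1 | 4 => half_sqrt2 | _ => half_sqrt3 end.

Definition frame_M (R : realType) (V : directions R) (i j : nat) : 'rV[R]_3 :=
  (frame_sin R j)^-1 *: (frame_y V i j - frame_cos R i j *: frame_D V i j).

Section Net.
Context {R : realType} (Q : nat -> nat -> quad R 2) (V : directions R).

(* The planar angles of F_{1,1}, F_{1,4}, F_{3,1} and F_{3,4} next to the corners of
   the net are arbitrary, so the corners are placed with the angles read off [Q]. *)
Definition net_row1 (j : nat) : 'rV[R]_3 :=
  match j with
  | 0 => - hlen Q 1 1 *: dir_e V 0
  | 1 => 0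
  | 2 => hlen Q 1 2 *: dir_e V 1
  | 3 => hlen Q 1 2 *: dir_e V 1 + hlen Q 1 3 *: dir_e V 2
  | _ => hlen Q 1 2 *: dir_e V 1 + hlen Q 1 3 *: dir_e V 2
         + hlen Q 1 4 *: dir_e V 3
  end.

Definition net_row2 (j : nat) : 'rV[R]_3 :=
  match j with
  | 0 => vlen Q 2 1 *: dir_d V - hlen Q 2 1 *: edge2 V 0
  | 1 | 2 | 3 => net_row1 j + vlen Q 2 j *: dir_d V
  | _ => net_row1 3 + vlen Q 2 3 *: dir_d V + hlen Q 2 4 *: edge2 V 3
  end.

Definition net_row0 (j : nat) : 'rV[R]_3 :=
  match j with
  | 0 => let t := angle (Q 1 1) bottom_left in
    net_row1 0 + edist (Q 1 1 bottom_left) (Q 1 1 top_left) *: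
      (- cos t *: frame_D V 1 1 + sin t *: frame_M V 1 1)
  | 1 | 2 | 3 => net_row1 j + vlen Q 1 j *: dir_u V
  | _ => let t := angle (Q 1 4) bottom_right in
    net_row1 4 + vlen Q 1 4 *: (cos t *: frame_D V 1 4 + sin t *: frame_M V 1 4)
  end.

Definition net_row3 (j : nat) : 'rV[R]_3 :=
  match j with
  | 0 => let t := angle (Q 3 1) top_left in
    net_row2 0 + edist (Q 3 1 top_left) (Q 3 1 bottom_left) *:
      (cos t *: frame_D V 3 1 + sin t *: frame_M V 3 1)
  | 1 | 2 | 3 => net_row2 j + vlen Q 3 j *: dir_w V
  | _ => let t := angle (Q 3 4) top_right in
    net_row2 4 + vlen Q 3 4 *: (- cos t *: frame_D V 3 4 + sin t *: frame_M V 3 4)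
  end.

Definition net (i j : nat) : 'rV[R]_3 :=
  match i with
  | 0 => net_row0 j
  | 1 => net_row1 j
  | 2 => net_row2 j
  | _ => net_row3 j
  end.

End Net.

(** * Fitting the net to the prescribed quadrilaterals *)

Lemma placedI (R : realType) (q : quad R 2) (q' : quad R 3) (k k1 k2 k3 : 'I_4)
    (D M : 'rV[R]_3) (e1 e2 e3 : R) :
  k + 1 = k1 -> k + 2 = k2 -> k + 3 = k3 ->
  edist (q k) (q k1) = e1 -> edist (q k1) (q k2) = e2 ->
  edist (q k) (q k3) = e3 ->
  q' k1 = q' k + e1 *: D ->
  q' k3 = q' k + e3 *: (cos (angle q k) *: D + sin (angle q k) *: M) ->
  q' k2 = q' k1 + e2 *: (- cos (angle q k1) *: D + sin (angle q k1) *: M) ->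
  placed q q' k D M.
Proof. by move=> <- <- <- <- <- <-. Qed.

Lemma is_face34P i j : is_face 3 4 i j ->
  [\/ i = 1, i = 2 | i = 3]%N /\ [\/ j = 1, j = 2, j = 3 | j = 4]%N.
Proof.
move=> /andP[/andP[i1 i3] /andP[j1 j4]]; split.
- by case: i i1 i3 => [//|[|[|[|//]]]] _ _; [apply: Or31|apply: Or32|apply: Or33].
- by case: j j1 j4 => [//|[|[|[|[|//]]]]] _ _;
    [apply: Or41|apply: Or42|apply: Or43|apply: Or44].
Qed.

Section Placement.
Context {R : realType} (Q : nat -> nat -> quad R 2).
Context (netQ : net_of_quads 3 4 Q).
Context (angles1 : forall i, (1 <= i <= 2)%N ->
    [/\ angle (Q i 1%N) bottom_right = pi / 4,
        angle (Q i.+1 1%N) top_right = pi / 4,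
        angle (Q i 2%N) bottom_left = 2 * pi / 3
      & angle (Q i.+1 2%N) top_left = 2 * pi / 3]).
Context (angles2 : forall i, (1 <= i <= 2)%N ->
    [/\ angle (Q i 2%N) bottom_right = pi / 3,
        angle (Q i.+1 2%N) top_right = pi / 3,
        angle (Q i 3%N) bottom_left = pi / 3
      & angle (Q i.+1 3%N) top_left = pi / 3]).
Context (angles3 : forall i, (1 <= i <= 2)%N ->
      angle (Q i 3%N) bottom_right = 2 * pi / 3
      /\ angle (Q i.+1 3%N) top_right = 2 * pi / 3).
Context (angles4 :
  [/\ angle (Q 2%N 4%N) top_left = 2 * (pi / 4) + pi / 4,
      angle (Q 2%N 4%N) bottom_left = 2 * (pi / 4) + pi / 4,
      angle (Q 1%N 4%N) bottom_left = pi / 4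
    & angle (Q 3%N 4%N) top_left = pi / 4]).

Let bl1 : bottom_left + 1 = top_left. Proof. exact/val_inj. Qed.
Let bl2 : bottom_left + 2 = top_right. Proof. exact/val_inj. Qed.
Let bl3 : bottom_left + 3 = bottom_right. Proof. exact/val_inj. Qed.
Let br1 : bottom_right + 1 = bottom_left. Proof. exact/val_inj. Qed.
Let br2 : bottom_right + 2 = top_left. Proof. exact/val_inj. Qed.
Let br3 : bottom_right + 3 = top_right. Proof. exact/val_inj. Qed.
Let tr1 : top_right + 1 = bottom_right. Proof. exact/val_inj. Qed.
Let tr2 : top_right + 2 = bottom_left. Proof. exact/val_inj. Qed.
Let tr3 : top_right + 3 = top_left. Proof. exact/val_inj. Qed.
Let tl1 : top_left + 1 = top_right. Proof. exact/val_inj. Qed.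
Let tl2 : top_left + 2 = bottom_right. Proof. exact/val_inj. Qed.
Let tl3 : top_left + 3 = bottom_left. Proof. exact/val_inj. Qed.

Lemma face_strictly_convex i j : is_face 3 4 i j -> strictly_convex (Q i j).
Proof. by case: netQ => h _ _; exact: h. Qed.

Lemma left_len i j : is_face 3 4 i j -> is_face 3 4 i j.+1 ->
  edist (Q i j.+1 top_left) (Q i j.+1 bottom_left) = vlen Q i j.
Proof. by case: netQ => _ h _ f f'; rewrite -h. Qed.

Lemma top_len i j : is_face 3 4 i j -> is_face 3 4 i.+1 j ->
  edist (Q i.+1 j top_left) (Q i.+1 j top_right) = hlen Q i j.
Proof. by case: netQ => _ _ h f f'; rewrite -h. Qed.

(** The left side of F_{2,2} is the base of a trapezoid with angles 2 pi / 3. Twice the cosine is -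
    1, so the right side is longer by one leg. In F_{2,3} below, the base is the right side. *)
Lemma middle_face2 :
  hlen Q 2 2 = hlen Q 1 2 /\ vlen Q 2 2 = vlen Q 2 1 + hlen Q 1 2.
Proof.
have [_ _ B1 _] := angles1 (isT : (1 <= 2 <= 2)%N).
have [_ _ _ B2] := angles1 (isT : (1 <= 1 <= 2)%N).
have [C1 _ _ _] := angles2 (isT : (1 <= 2 <= 2)%N).
have [_ C2 _ _] := angles2 (isT : (1 <= 1 <= 2)%N).
have := isosceles_trapezoid (q := Q 2 2) (k := bottom_left).
rewrite bl1 bl2 bl3 B1 B2 C1 C2 cos_pi3 cos_2pi3 opprK.
move=> /(_ (@face_strictly_convex 2 2 isT) erefl erefl erefl).
rewrite oppr_eq0 invr_eq0 pnatr_eq0 => /(_ isT) [].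
rewrite -/(hlen Q 2 2) (top_len (i := 1)) // (edistC (Q 2 2 bottom_right)).
rewrite -/(vlen Q 2 2) (edistC (Q 2 2 bottom_left)) left_len // => -> ->.
by split=> //; field.
Qed.

Lemma middle_face3 :
  hlen Q 2 3 = hlen Q 1 3 /\ vlen Q 2 2 = vlen Q 2 3 + hlen Q 1 3.
Proof.
have [B1 _] := angles3 (isT : (1 <= 2 <= 2)%N).
have [_ B2] := angles3 (isT : (1 <= 1 <= 2)%N).
have [_ _ C1 _] := angles2 (isT : (1 <= 2 <= 2)%N).
have [_ _ _ C2] := angles2 (isT : (1 <= 1 <= 2)%N).
have := isosceles_trapezoid (q := Q 2 3) (k := top_right).
rewrite tr1 tr2 tr3 B1 B2 C1 C2 cos_pi3 cos_2pi3 opprK.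
move=> /(_ (@face_strictly_convex 2 3 isT) erefl erefl erefl).
rewrite oppr_eq0 invr_eq0 pnatr_eq0 => /(_ isT) [].
rewrite (edistC (Q 2 3 top_right)) (top_len (i := 1)) //.
rewrite (edistC (Q 2 3 bottom_right)) -/(hlen Q 2 3) -/(vlen Q 2 3).
rewrite left_len // => <- ->.
by split=> //; field.
Qed.

(** Valid for arbitrary [V]: every face follows from the construction by linear identities. The
    trapezoid relations enter in columns 2 and 3 of rows 2 and 3, where the vertices of row 2 are
    built vertically but their edges must also be multiples of [edge2]. *)
Lemma placed_net (V : directions R) i j : is_face 3 4 i j ->
  placed (Q i j) (face (net Q V) i j) (frame_base i j)
    (frame_D V i j) (frame_M V i j).
Proof.
have [A11 _ B1 _] := angles1 (isT : (1 <= 1 <= 2)%N).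
have [A21 A1 B21 B2] := angles1 (isT : (1 <= 1 <= 2)%N).
have [A2 A3 B3 B4] := angles1 (isT : (1 <= 2 <= 2)%N).
have [C1 C2 C3 C4] := angles2 (isT : (1 <= 1 <= 2)%N).
have [C5 C6 C7 C8] := angles2 (isT : (1 <= 2 <= 2)%N).
have [B5 B6] := angles3 (isT : (1 <= 1 <= 2)%N).
have [B7 B8] := angles3 (isT : (1 <= 2 <= 2)%N).
have [D1 D2 D3 D4] := angles4.
have [h2 v2] := middle_face2; have [h3 v3] := middle_face3.
have r0 := lt0r_neq0 (half_sqrt2_gt0 R).
have s0 := lt0r_neq0 (half_sqrt3_gt0 R).
have fE i' j' k : face (net Q V) i' j' k =
   nth 0 [:: net Q V i'.-1 j'.-1; net Q V i'.-1 j'; net Q V i' j'; net Q V i' j'.-1] k.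
  by rewrite /face (tnth_nth 0).
have rV := half_sqrt2V R.
(* A side is [y] corrected by a multiple of [D]. The correction vanishes for sides parallel to [y];
   at the far end of a vertical side in row 2 it turns [y] into its mirror image, a multiple of
   [edge2]. *)
have sweep t e s (D y X : 'rV[R]_3) (c c' : R) : s != 0 -> sin t = s ->
    X = e *: (y + (c' - c) *: D) ->
    e *: (c' *: D + sin t *: (s^-1 *: (y - c *: D))) = X.
  by move=> s1 -> ->; apply/rowP => k; rewrite !mxE; field.
move=> /is_face34P[[] -> [] ->].
- apply: (placedI br1 br2 br3 (edistC _ _) erefl (edistC _ _)); rewrite !fE /=.
  + by rewrite -/(hlen Q 1 1) add0r scaleNr scalerN.
  + congr (_ + _); apply/esym/sweep; rewrite ?A11 ?cos_pi4 ?sin_pi4 //.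
    by rewrite subrr scale0r addr0.
  + by [].
- apply: (placedI br1 br2 br3 (edistC _ _) erefl (edistC _ _)); rewrite !fE /=.
  + by rewrite -/(hlen Q 1 2) scalerN subrr.
  + congr (_ + _); apply/esym/sweep; rewrite ?C1 ?cos_pi3 ?sin_pi3 //.
    by rewrite subrr scale0r addr0.
  + congr (_ + _); apply/esym/sweep; rewrite ?B1 ?cos_2pi3 ?sin_2pi3 //.
    by rewrite opprK subrr scale0r addr0 (edistC (Q 1 2 bottom_left)) left_len.
- apply: (placedI br1 br2 br3 (edistC _ _) erefl (edistC _ _)); rewrite !fE /=.
  + by rewrite -/(hlen Q 1 3) scalerN addrK.
  + congr (_ + _); apply/esym/sweep; rewrite ?B5 ?cos_2pi3 ?sin_2pi3 //.
    by rewrite subrr scale0r addr0.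
  + congr (_ + _); apply/esym/sweep; rewrite ?C3 ?cos_pi3 ?sin_pi3 //.
    by rewrite subrr scale0r addr0 (edistC (Q 1 3 bottom_left)) left_len.
- apply: (placedI br1 br2 br3 (edistC _ _) erefl (edistC _ _)); rewrite !fE /=.
  + by rewrite -/(hlen Q 1 4) scalerN addrK.
  + by [].
  + congr (_ + _); apply/esym/sweep; rewrite ?D3 ?cos_pi4 ?sin_pi4 //.
    by rewrite subrr scale0r addr0 (edistC (Q 1 4 bottom_left)) left_len.
- apply: (placedI tr1 tr2 tr3 erefl (edistC _ _) (edistC _ _)); rewrite !fE /=.
  + by [].
  + rewrite (top_len (i := 1)) // add0r; apply/esym/sweep; rewrite ?A1 ?cos_pi4 ?sin_pi4 //.
    by rewrite subrr scale0r addr0 scalerN scaleNr.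
  + rewrite -/(hlen Q 2 1) add0r; congr (_ + _).
    rewrite -scalerN; apply/esym/sweep; rewrite ?A2 ?cos_pi4 ?sin_pi4 //.
    by rewrite /edge2 /= rV; apply/rowP => c; rewrite !mxE; ring.
- apply: (placedI bl1 bl2 bl3 erefl erefl erefl); rewrite !fE /=.
  + by rewrite (edistC (Q 2 2 bottom_left)) left_len // scalerN add0r addrN.
  + rewrite -/(hlen Q 2 2) h2 v2.
    transitivity (0 + vlen Q 2 1 *: dir_d V + hlen Q 1 2 *: (dir_e V 1 + dir_d V)).
      by apply/rowP => c; rewrite !mxE; ring.
    congr (_ + _).
    apply/esym/sweep; rewrite ?B3 ?cos_2pi3 ?sin_2pi3 //.
    by rewrite /=; apply/rowP => c; rewrite !mxE; field.
  + rewrite (top_len (i := 1)) // add0r; apply/esym/sweep; rewrite ?B2 ?cos_2pi3 ?sin_2pi3 //.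
    by rewrite /=; apply/rowP => c; rewrite !mxE; field.
- apply: (placedI tr1 tr2 tr3 erefl (edistC _ _) (edistC _ _)); rewrite !fE /=.
  + by [].
  + rewrite (top_len (i := 1)) //; rewrite -[LHS](addrK (hlen Q 1 3 *: dir_e V 2)).
    congr (_ + _).
    apply/esym/sweep; rewrite ?B6 ?cos_2pi3 ?sin_2pi3 //.
    by rewrite subrr scale0r addr0 scalerN.
  + rewrite -/(hlen Q 2 3) h3 v3.
    transitivity (hlen Q 1 2 *: dir_e V 1 + hlen Q 1 3 *: dir_e V 2 + vlen Q 2 3 *: dir_d V
        + hlen Q 1 3 *: (- dir_e V 2 + dir_d V)).
      by apply/rowP => c; rewrite !mxE; ring.
    congr (_ + _).
    apply/esym/sweep; rewrite ?B7 ?cos_2pi3 ?sin_2pi3 //.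
    by rewrite /=; apply/rowP => c; rewrite !mxE; field.
- apply: (placedI bl1 bl2 bl3 erefl erefl erefl); rewrite !fE /=.
  + by rewrite (edistC (Q 2 4 bottom_left)) left_len // scalerN addrK.
  + rewrite -/(hlen Q 2 4); congr (_ + _).
    apply/esym/sweep; rewrite ?D2 ?cos_3pi4 ?sin_3pi4 //.
    by rewrite /edge2 /= rV; apply/rowP => c; rewrite !mxE; ring.
  + rewrite (top_len (i := 1)) //; congr (_ + _).
    apply/esym/sweep; rewrite ?D1 ?cos_3pi4 ?sin_3pi4 //.
    by rewrite opprK subrr scale0r addr0.
- apply: (placedI tl1 tl2 tl3 erefl erefl erefl); rewrite !fE /=.
  + by rewrite (top_len (i := 2)) // addrNK add0r.
  + by [].
  + congr (_ + _); apply/esym/sweep; rewrite ?A3 ?cos_pi4 ?sin_pi4 //.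
    by rewrite subrr scale0r addr0.
- apply: (placedI tl1 tl2 tl3 erefl erefl erefl); rewrite !fE /=.
  + rewrite (top_len (i := 2)) // h2 v2 /edge2 /=.
    by apply/rowP => c; rewrite !mxE; ring.
  + rewrite left_len //; congr (_ + _); apply/esym/sweep; rewrite ?B4 ?cos_2pi3 ?sin_2pi3 //.
    by rewrite subrr scale0r addr0.
  + congr (_ + _); apply/esym/sweep; rewrite ?C6 ?cos_pi3 ?sin_pi3 //.
    by rewrite opprK addNr scale0r addr0.
- apply: (placedI tl1 tl2 tl3 erefl erefl erefl); rewrite !fE /=.
  + rewrite (top_len (i := 2)) // h3 v3 /edge2 /=.
    by apply/rowP => c; rewrite !mxE; ring.
  + rewrite left_len //; congr (_ + _); apply/esym/sweep; rewrite ?C8 ?cos_pi3 ?sin_pi3 //.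
    by rewrite subrr scale0r addr0.
  + congr (_ + _); apply/esym/sweep; rewrite ?B8 ?cos_2pi3 ?sin_2pi3 //.
    by rewrite opprK addrN scale0r addr0.
- apply: (placedI tl1 tl2 tl3 erefl erefl erefl); rewrite !fE /=.
  + by rewrite (top_len (i := 2)).
  + rewrite left_len //; congr (_ + _); apply/esym/sweep; rewrite ?D4 ?cos_pi4 ?sin_pi4 //.
    by rewrite subrr scale0r addr0.
  + by [].
Qed.
End Placement.

(** * Two families of directions *)

Definition vec3 (R : realType) (x y z : R) : 'rV[R]_3 :=
  \row_k nth 0 [:: x; y; z] k.

Lemma dotp_vec3 (R : realType) (x y z x' y' z' : R) :
  dotp (vec3 x y z) (vec3 x' y' z') = x * x' + y * y' + z * z'.
Proof. by rewrite dotpE3 !mxE. Qed.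

Definition reflect_dir (R : realType) (d v : 'rV[R]_3) : 'rV[R]_3 :=
  v - (2 * dotp v d) *: d.

Lemma dotp_reflect (R : realType) (d v v' : 'rV[R]_3) :
  dotp d d = 1 -> dotp (reflect_dir d v) (reflect_dir d v') = dotp v v'.
Proof.
by move=> dd; rewrite /reflect_dir !dotp_linear dd (dotpC d); ring.
Qed.

(** Together with [placed_net], orthonormal frames make the three faces of the column congruent to
    the given quadrilaterals. *)
Definition rigid_column (R : realType) (V : directions R) (j : nat) : Prop :=
  forall i, (1 <= i <= 3)%N -> orthonormal2 (frame_D V i j) (frame_M V i j).

Lemma orthonormal_sweep (R : realType) (x y : 'rV[R]_3) (c s : R) :
  dotp x x = 1 -> dotp y y = 1 -> dotp x y = c -> s ^+ 2 = 1 - c ^+ 2 -> s != 0 ->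
  orthonormal2 x (s^-1 *: (y - c *: x)).
Proof.
move=> xx yy xy s2 s0; split; rewrite // !dotp_linear ?(dotpC y) xx ?yy xy.
  transitivity (s^-1 ^+ 2 * (1 - c ^+ 2)); first by ring.
  by rewrite -s2 -exprMn mulVf ?expr1n.
by rewrite mulr1 subrr mulr0.
Qed.

(** Cosines of the prescribed angles: [- dir_e V 0] makes the angle alpha with u and d, e_1 makes
    beta, e_2 makes gamma with both, while e_3 makes delta with u and 2 alpha + delta with d. The
    index is the column, hence one more than that of the edge. *)
Definition edge_dot_u (R : realType) (j : nat) : R :=
  match j with 1 => - half_sqrt2 | 2 => - 2^-1 | 3 => 2^-1 | _ => half_sqrt2 end.
Definition edge_dot_d (R : realType) (j : nat) : R :=
  match j with 1 => - half_sqrt2 | 2 => - 2^-1 | 3 => 2^-1 | _ => - half_sqrt2 end.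

(** Row 3 costs no further condition: its frame vectors are the reflections of those of row 1, and a
    reflection preserves inner products. *)
Lemma rigid_columnI (R : realType) (V : directions R) (j : nat) :
  (1 <= j <= 4)%N ->
  dotp (dir_u V) (dir_u V) = 1 -> dotp (dir_d V) (dir_d V) = 1 ->
  dir_w V = reflect_dir (dir_d V) (dir_u V) ->
  dotp (dir_e V j.-1) (dir_e V j.-1) = 1 ->
  dotp (dir_e V j.-1) (dir_u V) = edge_dot_u R j ->
  dotp (dir_e V j.-1) (dir_d V) = edge_dot_d R j ->
  rigid_column V j.
Proof.
move=> hj uu dd ew ee eu ed i hi.
have e2 : edge2 V j.-1 = reflect_dir (dir_d V) (dir_e V j.-1).
  rewrite /reflect_dir ed /edge2 -scaleNr; congr (_ + _ *: _).
  by case: j hj {ee eu ed} => [//|[|[|[|[|//]]]]] _ /=; rewrite ?half_sqrt2V; field.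
have ee2 : dotp (edge2 V j.-1) (edge2 V j.-1) = 1 by rewrite e2 dotp_reflect.
have ew2 : dotp (edge2 V j.-1) (dir_w V) = edge_dot_u R j.
  by rewrite e2 ew dotp_reflect.
have ww : dotp (dir_w V) (dir_w V) = 1 by rewrite ew dotp_reflect.
have r2 := sqr_half_sqrt2 R; have s2 := sqr_half_sqrt3 R.
have r0 := lt0r_neq0 (half_sqrt2_gt0 R).
have s0 := lt0r_neq0 (half_sqrt3_gt0 R).
move: ed eu ee ew2 ee2; move: hj.
case: j {e2} => [//|[|[|[|[|//]]]]] _; case: i hi => [//|[|[|[|//]]]] _ /= ed eu ee ew2 ee2.
all: apply: orthonormal_sweep => //; rewrite ?dotpNl ?dotpNr ?opprK //=.
all: rewrite ?(dotpC (dir_d V)) ?ed ?eu ?ew2 ?opprK //.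
all: rewrite ?sqrrN ?r2 ?s2 //; by field.
Qed.

(* The angle between u and d is bisected by the first coordinate axis; rigidity of
   the columns amounts to p^2 + q^2 = 2 p x = x^2 + z^2 = 1 for columns 2 and 3,
   y^2 + t^2 = 1 and y p = 1 / sqrt 2 for column 1, k^2 + t'^2 = 1 and
   k q = 1 / sqrt 2 for column 4. *)
Definition mirror_directions (R : realType) (p q x z y t k t' : R) : directions R :=
  let u := vec3 p q 0 in
  let d := vec3 p (- q) 0 in
  Directions u d (reflect_dir d u)
    (fun j => match j with
              | 0 => vec3 (- y) 0 t
              | 1 => vec3 (- x) 0 z
              | 2 => vec3 x 0 z
              | _ => vec3 0 k t'
              end).

Lemma mirror_rigid (R : realType) (p q x z y t k t' : R) (j : nat) :
  (1 <= j <= 4)%N ->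
  p ^+ 2 + q ^+ 2 = 1 -> 2 * p * x = 1 -> x ^+ 2 + z ^+ 2 = 1 ->
  (j = 1%N -> y ^+ 2 + t ^+ 2 = 1 /\ y * p = half_sqrt2) ->
  (j = 4%N -> k ^+ 2 + t' ^+ 2 = 1 /\ k * q = half_sqrt2) ->
  rigid_column (mirror_directions p q x z y t k t') j.
Proof.
move=> hj pq px xz h1 h4.
have xp : x * p = 2^-1 by lra.
apply: rigid_columnI => //=; rewrite ?dotp_vec3; try lra.
- case: j hj h1 h4 => [//|[|[|[|[|//]]]]] _ h1 h4 /=; rewrite dotp_vec3; try lra.
    by have [h _] := h1 erefl; lra.
  by have [h _] := h4 erefl; lra.
- case: j hj h1 h4 => [//|[|[|[|[|//]]]]] _ h1 h4 /=; rewrite dotp_vec3; try lra.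
    by have [_ h] := h1 erefl; lra.
  by have [_ h] := h4 erefl; lra.
- case: j hj h1 h4 => [//|[|[|[|[|//]]]]] _ h1 h4 /=; rewrite dotp_vec3; try lra.
    by have [_ h] := h1 erefl; lra.
  by have [_ h] := h4 erefl; lra.
Qed.

Definition base_directions (R : realType) : directions R :=
  mirror_directions half_sqrt2 half_sqrt2 half_sqrt2 half_sqrt2 1 0 1 0.

(** The rigidity equations of columns 1, 2, 3 solved from the component [t] of e_0 along the third
    axis. The final [1 0] keeps e_3 at its base position, so that the family passes through
    [base_directions]; column 4 is left out of this flex. *)
Definition left_directions (R : realType) (t : R) : directions R :=
  let y := Num.sqrt (1 - t * t) in
  let p := half_sqrt2 * y^-1 in
  let x := half_sqrt2 * y in
  mirror_directions p (Num.sqrt (1 - p * p)) x (Num.sqrt (1 - x * x)) y t 1 0.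

(** Here [t] is the third component of e_3, which determines [q] first; e_0 stays at its base
    position. *)
Definition right_directions (R : realType) (t : R) : directions R :=
  let k := Num.sqrt (1 - t * t) in
  let q := half_sqrt2 * k^-1 in
  let p := Num.sqrt (1 - q * q) in
  let x := 2^-1 * p^-1 in
  mirror_directions p q x (Num.sqrt (1 - x * x)) 1 0 k t.

Lemma sqr_sqrt1B (R : realType) (x : R) :
  x * x <= 1 -> Num.sqrt (1 - x * x) ^+ 2 = 1 - x ^+ 2.
Proof. by move=> h; rewrite sqr_sqrtr ?subr_ge0 // expr2. Qed.

Section Families.
Context {R : realType} (t : R).
Context (ht : - 2^-1 < t < 2^-1).
Local Notation r := (@half_sqrt2 R).

Lemma sqr_lt_quarter : 0 <= t * t < 4^-1.
Proof.
rewrite -expr2 sqr_ge0 /= expr2; case/andP: ht => t1 t2.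
have : 0 < (2^-1 - t) * (2^-1 + t) by rewrite mulr_gt0; lra.
lra.
Qed.

Lemma sqrt1B_bounds (y := Num.sqrt (1 - t * t)) :
  [/\ 0 < y, y * y = 1 - t * t, y ^+ 2 + t ^+ 2 = 1 & 3 / 4 < y * y <= 1].
Proof.
have /andP[t0 t1] := sqr_lt_quarter.
have y2 : y * y = 1 - t * t by rewrite -expr2 sqr_sqrt1B -?expr2 //; nra.
split=> //; first by rewrite sqrtr_gt0; lra.
  by rewrite !expr2 y2; ring.
by rewrite y2; apply/andP; split; lra.
Qed.

(** This number is [p] in the left family and [q] in the right one. Its square stays below 2 / 3 on
    the chosen interval, which keeps the remaining radicands positive. *)
Lemma half_sqrt2_div_bounds (q := r * (Num.sqrt (1 - t * t))^-1) :
  [/\ 0 < q, 2^-1 <= q * q, q * q < 2 / 3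
    & q * q * (2 * (1 - t * t)) = 1].
Proof.
have [y0 y2 _ /andP[y3 y1]] := sqrt1B_bounds.
have r0 := half_sqrt2_gt0 R; have r2 := sqr_half_sqrt2 R.
have qq : q * q * (2 * (1 - t * t)) = 1.
  rewrite /q; set y := Num.sqrt _ in y0 y2 *; rewrite -y2.
  transitivity (2 * r ^+ 2); last by rewrite r2; field.
  by field; exact: lt0r_neq0.
have q0 : 0 < q by rewrite mulr_gt0 // invr_gt0.
have qp : 0 < q * q by rewrite mulr_gt0.
by split=> //; rewrite y2 in y3 y1; nra.
Qed.

Lemma left_radicands :
  [/\ 0 < 1 - t * t, Num.sqrt (1 - t * t) != 0,
      0 < 1 - r * (Num.sqrt (1 - t * t))^-1 * (r * (Num.sqrt (1 - t * t))^-1)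
    & 0 < 1 - r * Num.sqrt (1 - t * t) * (r * Num.sqrt (1 - t * t))].
Proof.
have [y0 y2 _ /andP[y3 y1]] := sqrt1B_bounds.
have [q0 q1 q2 q3] := half_sqrt2_div_bounds.
split; [by nra|exact: lt0r_neq0|by lra|].
rewrite mulrACA -expr2 sqr_half_sqrt2; lra.
Qed.

Lemma right_radicands (q := r * (Num.sqrt (1 - t * t))^-1) :
  [/\ 0 < 1 - t * t, Num.sqrt (1 - t * t) != 0, 0 < 1 - q * q,
      Num.sqrt (1 - q * q) != 0
    & 0 < 1 - 2^-1 * (Num.sqrt (1 - q * q))^-1 * (2^-1 * (Num.sqrt (1 - q * q))^-1)].
Proof.
have [y0 y2 _ /andP[y3 y1]] := sqrt1B_bounds.
have [q0 q1 q2 q3] := half_sqrt2_div_bounds.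
have p0 : 0 < 1 - q * q by rewrite /q; lra.
split=> //; [by nra|exact: lt0r_neq0|by rewrite gt_eqF // sqrtr_gt0|].
set p := Num.sqrt _; have pp : p * p = 1 - q * q by rewrite -expr2 sqr_sqrtr ?ltW.
have -> : 2^-1 * p^-1 * (2^-1 * p^-1) = (4 * (p * p))^-1.
  by field; rewrite gt_eqF // sqrtr_gt0.
by rewrite pp subr_gt0 invf_lt1; rewrite /q; lra.
Qed.

Lemma left_rigid j : (1 <= j <= 3)%N -> rigid_column (left_directions t) j.
Proof.
move=> /andP[j1 j3].
have [y0 y2 y4 /andP[y3 y1]] := sqrt1B_bounds.
have [q0 q1 q2 q3] := half_sqrt2_div_bounds.
have [_ yn _ x1] := left_radicands.
have r2 := sqr_half_sqrt2 R.
apply: mirror_rigid; rewrite ?j1 ?(leq_trans j3) //.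
- by rewrite sqr_sqrt1B; [ring|lra].
- transitivity (2 * r ^+ 2); last by rewrite r2; field.
  by field.
- by rewrite sqr_sqrt1B; [ring|lra].
- by move=> _; split=> //; field.
- by move=> j4; rewrite j4 in j3.
Qed.

Lemma right_rigid j : (2 <= j <= 4)%N -> rigid_column (right_directions t) j.
Proof.
move=> /andP[j2 j4].
have [y0 y2 y4 /andP[y3 y1]] := sqrt1B_bounds.
have [q0 q1 q2 q3] := half_sqrt2_div_bounds.
have [_ yn _ pn x1] := right_radicands.
have r2 := sqr_half_sqrt2 R.
apply: mirror_rigid; rewrite ?j4 ?(leq_trans _ j2) //.
- by rewrite sqr_sqrt1B; [ring|lra].
- by field.
- by rewrite sqr_sqrt1B; [ring|lra].
- by move=> j1; rewrite j1 in j2.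
- by move=> _; split=> //; field.
Qed.

Lemma left_dotp_ud : t != 0 ->
  dotp (dir_u (left_directions t)) (dir_d (left_directions t)) != 0.
Proof.
have [q0 q1 q2 q3] := half_sqrt2_div_bounds.
move=> t0; rewrite dotp_vec3 mulr0 addr0 mulrN -expr2 -(expr2 (Num.sqrt _)).
rewrite sqr_sqrt1B; last lra.
apply/eqP => h; have t2 : 0 < t * t by rewrite -expr2 exprn_even_gt0.
nra.
Qed.

Lemma right_dotp_ud : t != 0 ->
  dotp (dir_u (right_directions t)) (dir_d (right_directions t)) != 0.
Proof.
have [q0 q1 q2 q3] := half_sqrt2_div_bounds.
move=> t0; rewrite dotp_vec3 mulr0 addr0 mulrN -!(expr2 (Num.sqrt _)).
rewrite sqr_sqrt1B; last lra.
apply/eqP => h; have t2 : 0 < t * t by rewrite -expr2 exprn_even_gt0.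
nra.
Qed.

End Families.

Lemma left_directions0 (R : realType) : left_directions 0 = base_directions R.
Proof.
have e : Num.sqrt (1 - 2^-1) = half_sqrt2 :> R by congr Num.sqrt; field.
rewrite /left_directions /base_directions mulr0 subr0 sqrtr1 invr1 !mulr1.
by rewrite -!expr2 !sqr_half_sqrt2 e.
Qed.

Lemma right_directions0 (R : realType) : right_directions 0 = base_directions R.
Proof.
have e : Num.sqrt (1 - 2^-1) = half_sqrt2 :> R by congr Num.sqrt; field.
rewrite /right_directions /base_directions mulr0 subr0 sqrtr1 invr1 !mulr1.
rewrite -!expr2 sqr_half_sqrt2 e half_sqrt2V.
have -> : 2^-1 * (2 * half_sqrt2) = half_sqrt2 :> R by field.
by rewrite sqr_half_sqrt2 e.
Qed.

Lemma base_rigid (R : realType) j :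
  (1 <= j <= 4)%N -> rigid_column (base_directions R) j.
Proof.
move=> /andP[j1 j4]; have h : - 2^-1 < (0 : R) < 2^-1 by apply/andP; split; lra.
case: (leqP j 3) => j3.
  by rewrite -left_directions0; apply: left_rigid; rewrite ?j1.
by rewrite -right_directions0; apply: right_rigid; rewrite ?j4 ?(leq_trans _ j3).
Qed.

Lemma base_dotp_ud (R : realType) :
  dotp (dir_u (base_directions R)) (dir_d (base_directions R)) = 0.
Proof. by rewrite dotp_vec3; ring. Qed.

(** * Smoothness of the two families *)

Definition smooth_vec (R : realType) (eps : R) (f : R -> 'rV[R]_3) : Prop :=
  forall l, smooth_on eps (fun t => f t 0 l).

Definition smooth_directions (R : realType) (eps : R) (W : R -> directions R) : Prop :=
  [/\ smooth_vec eps (fun t => dir_u (W t)), smooth_vec eps (fun t => dir_d (W t)),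
      smooth_vec eps (fun t => dir_w (W t))
    & forall j, smooth_vec eps (fun t => dir_e (W t) j)].

Lemma smooth_onM (R : realType) (eps : R) (f g : R -> R) :
  smooth_on eps f -> smooth_on eps g -> smooth_on eps (fun t => f t * g t).
Proof. by move=> hf hg n; exact: cont_diffM. Qed.

Lemma smooth_onD (R : realType) (eps : R) (f g : R -> R) :
  smooth_on eps f -> smooth_on eps g -> smooth_on eps (fun t => f t + g t).
Proof. by move=> hf hg n; exact: cont_diffD. Qed.

Lemma smooth_cst (R : realType) (eps : R) (c : R) : smooth_on eps (fun=> c).
Proof. by move=> n; exact: cont_diff_cst. Qed.

Lemma smooth_onN (R : realType) (eps : R) (f : R -> R) :
  smooth_on eps f -> smooth_on eps (fun t => - f t).
Proof.
move=> hf n; apply: (@cont_diff_ext _ _ _ (fun t => -1 * f t)).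
  by move=> t; rewrite mulN1r.
exact: (smooth_onM (smooth_cst _ _)).
Qed.

Lemma smooth_onB (R : realType) (eps : R) (f g : R -> R) :
  smooth_on eps f -> smooth_on eps g -> smooth_on eps (fun t => f t - g t).
Proof. by move=> hf hg; apply: smooth_onD => //; exact: smooth_onN. Qed.

Lemma smooth_onV (R : realType) (eps : R) (f : R -> R) :
  (forall t, - eps < t < eps -> f t != 0) ->
  smooth_on eps f -> smooth_on eps (fun t => (f t)^-1).
Proof. by move=> h hf n; exact: cont_diffV. Qed.

Lemma smooth_on_sqrt (R : realType) (eps : R) (f : R -> R) :
  (forall t, - eps < t < eps -> 0 < f t) ->
  smooth_on eps f -> smooth_on eps (fun t => Num.sqrt (f t)).
Proof. by move=> h hf n; exact: cont_diff_sqrt. Qed.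

Lemma smooth_vecD (R : realType) (eps : R) (f g : R -> 'rV[R]_3) :
  smooth_vec eps f -> smooth_vec eps g -> smooth_vec eps (fun t => f t + g t).
Proof.
move=> hf hg l n; apply: (@cont_diff_ext _ _ _ (fun t => f t 0 l + g t 0 l)).
  by move=> t; rewrite mxE.
exact: smooth_onD.
Qed.

Lemma smooth_vecZ (R : realType) (eps : R) (f : R -> R) (g : R -> 'rV[R]_3) :
  smooth_on eps f -> smooth_vec eps g -> smooth_vec eps (fun t => f t *: g t).
Proof.
move=> hf hg l n; apply: (@cont_diff_ext _ _ _ (fun t => f t * g t 0 l)).
  by move=> t; rewrite mxE.
exact: smooth_onM.
Qed.

Lemma smooth_vecN (R : realType) (eps : R) (g : R -> 'rV[R]_3) :
  smooth_vec eps g -> smooth_vec eps (fun t => - g t).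
Proof.
move=> hg l n; apply: (@cont_diff_ext _ _ _ (fun t => - (g t 0 l))).
  by move=> t; rewrite mxE.
exact: smooth_onN.
Qed.

Lemma smooth_vecB (R : realType) (eps : R) (f g : R -> 'rV[R]_3) :
  smooth_vec eps f -> smooth_vec eps g -> smooth_vec eps (fun t => f t - g t).
Proof. by move=> hf hg; apply: smooth_vecD => //; exact: smooth_vecN. Qed.

Lemma smooth_vec3 (R : realType) (eps : R) (f g h : R -> R) :
  smooth_on eps f -> smooth_on eps g -> smooth_on eps h ->
  smooth_vec eps (fun t => vec3 (f t) (g t) (h t)).
Proof.
move=> hf hg hh [[|[|[|//]]] l] n.
- by apply: cont_diff_ext (hf n) => t; rewrite mxE.
- by apply: cont_diff_ext (hg n) => t; rewrite mxE.
- by apply: cont_diff_ext (hh n) => t; rewrite mxE.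
Qed.

Lemma smooth_dotp (R : realType) (eps : R) (f g : R -> 'rV[R]_3) :
  smooth_vec eps f -> smooth_vec eps g -> smooth_on eps (fun t => dotp (f t) (g t)).
Proof.
move=> hf hg n; apply: cont_diff_ext (fun t => esym (dotpE3 (f t) (g t))) _.
by apply: smooth_onD; [apply: smooth_onD|]; apply: smooth_onM.
Qed.

Lemma smooth_cross (R : realType) (eps : R) (f g : R -> 'rV[R]_3) :
  smooth_vec eps f -> smooth_vec eps g -> smooth_vec eps (fun t => cross (f t) (g t)).
Proof.
move=> hf hg l n.
apply: (@cont_diff_ext _ _ _ (fun t =>
  f t 0 (l + 1) * g t 0 (l + 2) - f t 0 (l + 2) * g t 0 (l + 1))).
  by move=> t; rewrite mxE.
by apply: smooth_onB; apply: smooth_onM.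
Qed.

Lemma smooth_mirror (R : realType) (eps : R) (p q x z y t k t' : R -> R) :
  smooth_on eps p -> smooth_on eps q -> smooth_on eps x -> smooth_on eps z ->
  smooth_on eps y -> smooth_on eps t -> smooth_on eps k -> smooth_on eps t' ->
  smooth_directions eps
    (fun s => mirror_directions (p s) (q s) (x s) (z s) (y s) (t s) (k s) (t' s)).
Proof.
move=> hp hq hx hz hy ht hk ht'.
have c0 := smooth_cst eps (0 : R).
have su : smooth_vec eps (fun s => vec3 (p s) (q s) 0) by exact: smooth_vec3.
have sd : smooth_vec eps (fun s => vec3 (p s) (- q s) 0).
  by apply: smooth_vec3 => //; exact: smooth_onN.
split=> //=.
  apply: smooth_vecB => //; apply: smooth_vecZ => //.
  by apply: smooth_onM; [exact: smooth_cst|exact: smooth_dotp].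
by case=> [|[|[|j]]]; apply: smooth_vec3 => //; exact: smooth_onN.
Qed.

Lemma smooth_left (R : realType) : smooth_directions (2^-1 : R) (@left_directions R).
Proof.
have sc c := smooth_cst (2^-1 : R) c.
have sid : smooth_on (2^-1 : R) id by move=> n; exact: cont_diff_id.
have sy : smooth_on (2^-1 : R) (fun t => Num.sqrt (1 - t * t)).
  apply: smooth_on_sqrt => [t /left_radicands[]//|].
  by apply: smooth_onB => //; exact: smooth_onM.
have sp : smooth_on (2^-1 : R) (fun t => half_sqrt2 * (Num.sqrt (1 - t * t))^-1).
  apply: smooth_onM => //; apply: smooth_onV => // t /left_radicands[] //.
have sx : smooth_on (2^-1 : R) (fun t => half_sqrt2 * Num.sqrt (1 - t * t)).
  exact: smooth_onM.
apply: smooth_mirror => //.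
  apply: smooth_on_sqrt => [t /left_radicands[]//|].
  by apply: smooth_onB => //; exact: smooth_onM.
apply: smooth_on_sqrt => [t /left_radicands[]//|].
by apply: smooth_onB => //; exact: smooth_onM.
Qed.

Lemma smooth_right (R : realType) : smooth_directions (2^-1 : R) (@right_directions R).
Proof.
have sc c := smooth_cst (2^-1 : R) c.
have sid : smooth_on (2^-1 : R) id by move=> n; exact: cont_diff_id.
have sk : smooth_on (2^-1 : R) (fun t => Num.sqrt (1 - t * t)).
  apply: smooth_on_sqrt => [t /right_radicands[]//|].
  by apply: smooth_onB => //; exact: smooth_onM.
have sq : smooth_on (2^-1 : R) (fun t => half_sqrt2 * (Num.sqrt (1 - t * t))^-1).
  apply: smooth_onM => //; apply: smooth_onV => // t /right_radicands[] //.
pose q (t : R) := half_sqrt2 * (Num.sqrt (1 - t * t))^-1.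
have sp : smooth_on (2^-1 : R) (fun t => Num.sqrt (1 - q t * q t)).
  apply: smooth_on_sqrt => [t /right_radicands[]//|].
  by apply: smooth_onB => //; exact: smooth_onM.
have sx : smooth_on (2^-1 : R) (fun t => 2^-1 * (Num.sqrt (1 - q t * q t))^-1).
  by apply: smooth_onM => //; apply: smooth_onV => // t /right_radicands[].
apply: smooth_mirror => //.
apply: smooth_on_sqrt => [t /right_radicands[]//|].
by apply: smooth_onB => //; exact: smooth_onM.
Qed.

(** * Flexibility of the subnets *)

Lemma smooth_vec_cst (R : realType) (eps : R) (v : 'rV[R]_3) :
  smooth_vec eps (fun=> v).
Proof. by move=> l; exact: smooth_cst. Qed.

Lemma face_drop_columns (R : realType) c (p : vertices R) i j :
  (0 < j)%N -> face (drop_columns c p) i j = face p i (c + j).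
Proof. by case: j => // j _; rewrite /face /drop_columns addnS. Qed.

Lemma tr_rows3_mulmx (R : realType) (u v w u' v' w' : 'rV[R]_3) k l :
  ((rows3 u v w)^T *m rows3 u' v' w') k l =
  u 0 k * u' 0 l + v 0 k * v' 0 l + w 0 k * w' 0 l.
Proof.
by rewrite mxE !big_ord_recl big_ord0 addr0 addrA !mxE !(tnth_nth 0).
Qed.

Lemma placed_motion (R : realType) (q : quad R 2) (q0 qt : quad R 3) (k : 'I_4)
    (D0 M0 Dt Mt : 'rV[R]_3) (A : 'M_3) :
  placed q q0 k D0 M0 -> placed q qt k Dt Mt ->
  D0 *m A = Dt -> M0 *m A = Mt ->
  forall l, qt l = q0 l *m A + (qt k - q0 k *m A).
Proof.
move=> p0 pt AD AM l; have [x [y xyP]] := placed_coords q k.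
rewrite (xyP _ _ _ p0) (xyP _ _ _ pt) !mulmxDl -!scalemxAl AD AM.
by set X := q0 k *m A; apply/rowP => i; rewrite !mxE; ring.
Qed.

Section SmoothNet.
Context {R : realType} (Q : nat -> nat -> quad R 2) (eps : R) (W : R -> directions R).
Context (sW : smooth_directions eps W).

Lemma smooth_edge2 j : smooth_vec eps (fun t => edge2 (W t) j).
Proof.
have [su sd sw se] := sW.
by apply: smooth_vecD => //; apply: smooth_vecZ => //; exact: smooth_cst.
Qed.

Lemma smooth_frame_D i j : smooth_vec eps (fun t => frame_D (W t) i j).
Proof.
have [su sd sw se] := sW; have se2 := smooth_edge2.
case: i => [|[|[|i]]] //=; first exact: smooth_vecN.
by case: odd => //; exact: smooth_vecN.
Qed.

Lemma smooth_frame_y i j : smooth_vec eps (fun t => frame_y (W t) i j).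
Proof.
have [su sd sw se] := sW.
by case: i => [|[|[|i]]] //; case: j => [|[|[|[|j]]]] //=; exact: smooth_vecN.
Qed.

Lemma smooth_frame_M i j : smooth_vec eps (fun t => frame_M (W t) i j).
Proof.
apply: smooth_vecZ; first exact: smooth_cst.
apply: smooth_vecB; first exact: smooth_frame_y.
by apply: smooth_vecZ; [exact: smooth_cst|exact: smooth_frame_D].
Qed.

Lemma smooth_net_row1 j : smooth_vec eps (fun t => net_row1 Q (W t) j).
Proof.
have [su sd sw se] := sW; have sc := smooth_cst eps.
have sZ c i : smooth_vec eps (fun t => c *: dir_e (W t) i) by exact: smooth_vecZ.
case: j => [|[|[|[|j]]]] /=.
- exact: sZ.
- exact: smooth_vec_cst.
- exact: sZ.
- exact: smooth_vecD.
- by apply: smooth_vecD => //; exact: smooth_vecD.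
Qed.

Lemma smooth_net_row2 j : smooth_vec eps (fun t => net_row2 Q (W t) j).
Proof.
have [su sd sw se] := sW; have sc := smooth_cst eps.
have sZ c : smooth_vec eps (fun t => c *: dir_d (W t)) by exact: smooth_vecZ.
have sE c i : smooth_vec eps (fun t => c *: edge2 (W t) i).
  by apply: smooth_vecZ => //; exact: smooth_edge2.
have s1 := smooth_net_row1.
case: j => [|[|[|[|j]]]] /=; first exact: smooth_vecB.
- exact: (smooth_vecD (s1 1%N)).
- exact: (smooth_vecD (s1 2%N)).
- exact: (smooth_vecD (s1 3%N)).
- apply: smooth_vecD => //; exact: (smooth_vecD (s1 3%N)).
Qed.

Lemma smooth_face_base i j : is_face 3 4 i j ->
  smooth_vec eps (fun t => face (net Q (W t)) i j (frame_base i j)).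
Proof.
have s1 := smooth_net_row1; have s2 := smooth_net_row2.
move=> /is_face34P[[] -> [] ->]; rewrite /face /=.
- exact: (s1 1%N).
- exact: (s1 2%N).
- exact: (s1 3%N).
- exact: (s1 4%N).
- exact: (s1 1%N).
- exact: (s2 1%N).
- exact: (s1 3%N).
- exact: (s2 3%N).
- exact: (s2 0%N).
- exact: (s2 1%N).
- exact: (s2 2%N).
- exact: (s2 3%N).
Qed.

Lemma smooth_frame_rotation i j k l :
  smooth_on eps (fun t => frame_rotation (frame_D (W 0) i j) (frame_M (W 0) i j)
    (frame_D (W t) i j) (frame_M (W t) i j) k l).
Proof.
have sD := smooth_frame_D i j; have sM := smooth_frame_M i j.
have sC := smooth_cross sD sM.
pose D0 := frame_D (W 0) i j; pose M0 := frame_M (W 0) i j.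
move=> n; apply: (@cont_diff_ext _ _ _ (fun t => D0 0 k * frame_D (W t) i j 0 l
  + M0 0 k * frame_M (W t) i j 0 l
  + cross D0 M0 0 k * cross (frame_D (W t) i j) (frame_M (W t) i j) 0 l)).
  by move=> t; rewrite tr_rows3_mulmx.
have sc := smooth_cst eps.
by apply: smooth_onD; [apply: smooth_onD|]; apply: smooth_onM => //.
Qed.

End SmoothNet.

Section Flexibility.
Context {R : realType} (Q : nat -> nat -> quad R 2).
Context (cvxQ : forall i j, is_face 3 4 i j -> strictly_convex (Q i j)).
Context (placedQ : forall V i j, is_face 3 4 i j ->
  placed (Q i j) (face (net Q V) i j) (frame_base i j)
    (frame_D V i j) (frame_M V i j)).

Lemma net_image V i j : is_face 3 4 i j -> rigid_column V j ->
  isometric_image (Q i j) (face (net Q V) i j).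
Proof.
move=> f rc; apply: (placed_image (cvxQ f) _ (placedQ V f)).
by apply: rc; case/andP: f.
Qed.

Lemma frame_yE (V : directions R) i j :
  frame_y V i j = frame_sin R j *: frame_M V i j + frame_cos R i j *: frame_D V i j.
Proof.
have r0 := lt0r_neq0 (half_sqrt2_gt0 R).
have s0 := lt0r_neq0 (half_sqrt3_gt0 R).
have sn0 : frame_sin R j != 0 by case: j => [|[|[|[|[|j]]]]].
by rewrite scalerA mulfV // scale1r subrK.
Qed.

(** Each face moves by the rotation between its frames at times 0 and [t], with the translation
    fixed by its base vertex. Neighbouring faces stay glued because all positions are read off one
    net. The motion is non-trivial because a common rotation would preserve the inner product of u
    and d. *)
Lemma net_flexible (W : R -> directions R) (c n : nat) :
  (c <= 1)%N -> (2 <= c + n <= 4)%N ->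
  (forall t, - 2^-1 < t < 2^-1 -> forall j, (c < j <= c + n)%N ->
    rigid_column (W t) j) ->
  smooth_directions 2^-1 W ->
  dotp (dir_u (W 0)) (dir_d (W 0)) = 0 ->
  (forall t, - 2^-1 < t < 2^-1 -> t != 0 ->
    dotp (dir_u (W t)) (dir_d (W t)) != 0) ->
  flexible 3 n (drop_columns c (net Q (W 0))).
Proof.
move=> c1 /andP[cn2 cn4] rig smW ud0 udt.
have range0 : - 2^-1 < (0 : R) < 2^-1 by apply/andP; split; lra.
pose A i j t := frame_rotation (frame_D (W 0) i (c + j)) (frame_M (W 0) i (c + j))
    (frame_D (W t) i (c + j)) (frame_M (W t) i (c + j)).
pose o i j t := face (net Q (W t)) i (c + j) (frame_base i (c + j)).
pose b i j t := o i j t - o i j 0 *m A i j t.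
have faceP i j : is_face 3 n i j -> [/\ is_face 3 4 i (c + j), (0 < j)%N, (1 <= i <= 3)%N
    & (c < c + j <= c + n)%N].
  move=> /andP[hi /andP[j1 jn]]; split=> //.
    by rewrite /is_face hi addn_gt0 j1 orbT (leq_trans _ cn4) // leq_add2l.
  by rewrite -addn1 !leq_add2l j1.
have ort t i j : - 2^-1 < t < 2^-1 -> is_face 3 n i j ->
    orthonormal2 (frame_D (W t) i (c + j)) (frame_M (W t) i (c + j)).
  by move=> ht /faceP[_ _ hi hj]; exact: rig.
have AP t i j : - 2^-1 < t < 2^-1 -> is_face 3 n i j -> [/\ rotation_mx (A i j t),
    frame_D (W 0) i (c + j) *m A i j t = frame_D (W t) i (c + j)
  & frame_M (W 0) i (c + j) *m A i j t = frame_M (W t) i (c + j)].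
  by move=> ht f; apply: frame_rotationP; apply: ort.
exists 2^-1, (fun t => drop_columns c (net Q (W t))), A, b; split; first by rewrite invr_gt0.
- split=> // [t ht i j f|i j f].
    have [f4 j0 hi hj] := faceP _ _ f.
    rewrite face_drop_columns //.
    have im := net_image f4 (rig t ht _ hj).
    split; first exact: image_coplanar im.
    by apply: image_simple im _; apply: strictly_convex_simple; exact: cvxQ.
  have [f4 j0 hi hj] := faceP _ _ f.
  split.
  + have A0 : A i j 0 = 1%:M by apply/frame_rotation_id/ort.
    by rewrite A0 /b A0 mulmx1 subrr.
  + by move=> k l; apply/smooth_on_near0/smooth_frame_rotation.
  + have sA k l : smooth_on 2^-1 (fun t => A i j t k l) by exact: smooth_frame_rotation.
    have so : smooth_vec 2^-1 (o i j) by exact: smooth_face_base.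
    move=> l; apply/smooth_on_near0 => m.
    apply: (@cont_diff_ext _ _ _ (fun t => o i j t 0 l - (o i j 0 0 0 * A i j t 0 l
      + o i j 0 0 1 * A i j t 1 l + o i j 0 0 2 * A i j t 2 l))).
      move=> t; rewrite [RHS]mxE [X in _ = _ + X]mxE [X in _ = _ - X]mxE.
      rewrite !big_ord_recl big_ord0 addr0 addrA.
      by congr (_ - (_ * A i j t _ _ + o i j 0 0 _ * A i j t _ _
        + o i j 0 0 _ * A i j t _ _)); apply/val_inj.
    have sAc x k : smooth_on 2^-1 (fun t => x * A i j t k l).
      exact: (smooth_onM (smooth_cst _ x) (sA k l)).
    exact: (smooth_onB (so l) (smooth_onD (smooth_onD (sAc _ _) (sAc _ _)) (sAc _ _))).
  + move=> t ht; have [[A1 A2] AD AM] := AP t _ _ ht f; split=> // k.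
    have fd t' : face (drop_columns c (net Q (W t'))) i j k = face (net Q (W t')) i (c + j) k.
      exact: (congr1 (@^~ k) (face_drop_columns _ _ _ j0)).
    have h := placed_motion (placedQ (W 0) f4) (placedQ (W t) f4) AD AM k.
    exact: (etrans (fd t) (etrans h (congr1 (fun v => v *m A i j t + b i j t) (esym (fd 0))))).
- move=> triv.
  have ht : - 2^-1 < (4^-1 : R) < 2^-1 by apply/andP; split; lra.
  (* Column 2 belongs to both subnets. Its first face contains u in its frame, its second one [- d],
     so these two faces witness non-triviality; 1 / 4 is just a nonzero time in the interval. *)
  have c2 : (c + (2 - c))%N = 2%N by rewrite subnKC // (leq_trans c1).
  have f1 : is_face 3 n 1 (2 - c).
    by rewrite /is_face /= subn_gt0 ltnS c1 leq_subLR.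
  have f2 : is_face 3 n 2 (2 - c) by [].
  have [eA _] := triv _ _ _ _ _ f1 f2 ht.
  have [[A1 A2] AD1 AM1] := AP _ _ _ ht f1; have [_ AD2 AM2] := AP _ _ _ ht f2.
  rewrite -eA c2 in AD2; rewrite c2 in AD1 AM1.
  have := udt _ ht; rewrite invr_eq0 pnatr_eq0 => /(_ isT) /eqP; apply.
  have eu : dir_u (W 0) *m A 1%N (2 - c)%N 4^-1 = dir_u (W 4^-1).
    rewrite -[dir_u (W 0)]/(frame_y (W 0) 1 2) -[RHS]/(frame_y (W 4^-1) 1 2).
    rewrite !frame_yE mulmxDl -(scalemxAl (frame_sin R 2)).
    by rewrite -(scalemxAl (frame_cos R 1 2)) AD1 AM1.
  have ed : dir_d (W 0) *m A 1%N (2 - c)%N 4^-1 = dir_d (W 4^-1).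
    by apply: oppr_inj; rewrite -mulNmx.
  by rewrite -eu -ed dotp_mulmx_orth.
Qed.

End Flexibility.

(** * Rigidity of the whole net *)

(* [dotp (e0 + r (u + d)) (e0 + r (u + d)) = dotp u d] and
   [dotp (e3 - r (u - d)) (e3 - r (u - d)) = - dotp u d], so both vanish. *)
Lemma flat_and_folded (R : realType) (u d e0 e3 : 'rV[R]_3) :
  dotp u u = 1 -> dotp d d = 1 -> dotp e0 e0 = 1 -> dotp e3 e3 = 1 ->
  dotp e0 u = - half_sqrt2 -> dotp e0 d = - half_sqrt2 ->
  dotp e3 u = half_sqrt2 -> dotp e3 d = - half_sqrt2 ->
  [/\ dotp u d = 0, e0 = - half_sqrt2 *: (u + d) & e3 = half_sqrt2 *: (u - d)].
Proof.
move=> uu dd e00 e33 e0u e0d e3u e3d.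
have r2 := sqr_half_sqrt2 R; set r := half_sqrt2 in r2 e0u e0d e3u e3d *.
pose X := e0 + r *: (u + d); pose Y := e3 - r *: (u - d).
have X0 : dotp X X = dotp u d.
  rewrite /X !dotp_linear !(dotpC u e0) !(dotpC d) uu dd e00 e0u e0d.
  transitivity (1 - 4 * r ^+ 2 + 2 * r ^+ 2 * (1 + dotp u d)); first by ring.
  by rewrite r2; field.
have Y0 : dotp Y Y = - dotp u d.
  rewrite /Y !dotp_linear !(dotpC u e3) !(dotpC d) uu dd e33 e3u e3d.
  transitivity (1 - 4 * r ^+ 2 + 2 * r ^+ 2 * (1 - dotp u d)); first by ring.
  by rewrite r2; field.
have ud : dotp u d = 0 by have := dotp_ge0 X; have := dotp_ge0 Y; lra.
split=> //.
- by apply/eqP; rewrite -subr_eq0 scaleNr opprK; apply/eqP/dotp_eq0; rewrite -/X X0.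
- by apply/eqP; rewrite -subr_eq0; apply/eqP/dotp_eq0; rewrite -/Y Y0 ud oppr0.
Qed.

Lemma orthonormal_ext (R : realType) (u d x y : 'rV[R]_3) :
  orthonormal2 u d -> dotp x u = dotp y u -> dotp x d = dotp y d ->
  dotp x (cross u d) = dotp y (cross u d) -> x = y.
Proof.
move=> /rows3_rotation [F1 _] hu hd hn; apply/eqP; rewrite -subr_eq0; apply/eqP.
rewrite -[LHS]mulmx1 -(mulmx1C F1) mulmxA; set F := rows3 _ _ _.
suff -> : (x - y) *m F^T = 0 by rewrite mul0mx.
apply/rowP => i; rewrite [RHS]mxE.
have -> : ((x - y) *m F^T) 0 i = dotp (x - y) (row i F).
  by rewrite mxE; apply: eq_bigr => k _; rewrite !mxE.
rewrite row_rows3 dotpDl dotpNl.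
by case: i => -[|[|[|//]]] i; rewrite (tnth_nth 0) /= ?hu ?hd ?hn subrr.
Qed.

(** The square of a triple product is the Gram determinant, expanded in the intermediate
    expression. *)
Lemma sqr_dotp_cross (R : realType) (u d x : 'rV[R]_3) :
  orthonormal2 u d ->
  dotp x (cross u d) ^+ 2 = dotp x x - dotp x u ^+ 2 - dotp x d ^+ 2.
Proof.
move=> [uu dd ud].
have [c0 c1 c2] := crossE u d.
transitivity (dotp x x * (dotp u u * dotp d d - dotp u d ^+ 2)
  - dotp x u * (dotp x u * dotp d d - dotp u d * dotp x d)
  + dotp x d * (dotp x u * dotp u d - dotp u u * dotp x d)).
  by rewrite !dotpE3 c0 c1 c2; ring.
by rewrite uu dd ud; ring.
Qed.

Lemma cross_neq0 (R : realType) (x y : 'rV[R]_3) :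
  dotp x x = 1 -> dotp y y = 1 -> dotp x y ^+ 2 != 1 -> cross x y != 0.
Proof.
move=> xx yy; apply: contra => /eqP c0; have [_ _] := dotp_cross x y.
rewrite xx yy c0 mulr1 -{1}(mul0mx _ (1%:M : 'M_3)) dotp_mulmx mul0mx mul0mx mxE.
by move/eqP; rewrite eq_sym subr_eq0 eq_sym.
Qed.

Definition continuous_near0 (R : realType) (eps : R) (f : R -> R) : Prop :=
  forall t, - eps < t < eps -> {for t, continuous f}.

(** A change of sign would produce a zero by the intermediate value theorem, but the square is a
    positive constant. *)
Lemma constant_of_sqr (R : realType) (eps c : R) (f : R -> R) :
  0 < c -> continuous_near0 eps f ->
  (forall t, - eps < t < eps -> f t ^+ 2 = c) ->
  forall t, - eps < t < eps -> f t = f 0.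
Proof.
move=> c0 cf f2 t ht.
have h0 : - eps < (0 : R) < eps by case/andP: ht => a b; apply/andP; split; lra.
pose lo := Num.min 0 t; pose hi := Num.max 0 t.
have lohi : lo <= hi by rewrite ge_min !le_max !lexx.
have inI s : s \in `[lo, hi] -> - eps < s < eps.
  rewrite in_itv /= => /andP[]; rewrite ge_min le_max => a b.
  by case/andP: ht h0 => t1 t2 /andP[z1 z2]; case/orP: a; case/orP: b => b a;
    apply/andP; split; lra.
have fc : {within `[lo, hi], continuous f}.
  apply: continuous_in_subspaceT => s; rewrite inE /= => hs.
  by apply: cf; apply: inI.
have fn s : s \in `[lo, hi] -> f s != 0.
  by move=> /inI /f2 h; apply: contraTneq c0 => z; rewrite -h z expr0n ltxx.
have := f2 _ ht; rewrite -(f2 _ h0) => /eqP; rewrite eqf_sqr => /orP[/eqP //|/eqP e].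
have : Num.min (f lo) (f hi) <= 0 <= Num.max (f lo) (f hi).
  have [[-> ->]|[-> ->]] : (lo = 0 /\ hi = t) \/ (lo = t /\ hi = 0).
  - rewrite /lo /hi; case: (leP 0 t) => h; [left|right] => //.
  - rewrite e ge_min le_max oppr_le0 oppr_ge0.
    by have /orP[->|->] := le_total 0 (f 0); rewrite ?orbT.
  - rewrite e ge_min le_max oppr_le0 oppr_ge0.
    by have /orP[->|->] := le_total 0 (f 0); rewrite ?orbT.
move/(IVT lohi fc) => [s hs fs].
by have := fn s hs; rewrite fs eqxx.
Qed.

Lemma continuous_near0M (R : realType) (eps : R) (f g : R -> R) :
  continuous_near0 eps f -> continuous_near0 eps g ->
  continuous_near0 eps (fun t => f t * g t).
Proof. by move=> hf hg t ht; apply: cvgM; [exact: hf|exact: hg]. Qed.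

Lemma continuous_near0D (R : realType) (eps : R) (f g : R -> R) :
  continuous_near0 eps f -> continuous_near0 eps g ->
  continuous_near0 eps (fun t => f t + g t).
Proof. by move=> hf hg t ht; apply: cvgD; [exact: hf|exact: hg]. Qed.

Lemma continuous_near0B (R : realType) (eps : R) (f g : R -> R) :
  continuous_near0 eps f -> continuous_near0 eps g ->
  continuous_near0 eps (fun t => f t - g t).
Proof. by move=> hf hg t ht; apply: cvgB; [exact: hf|exact: hg]. Qed.

Lemma continuous_near0_cst (R : realType) (eps c : R) :
  continuous_near0 eps (fun=> c).
Proof. by move=> t ht; exact: cvg_cst. Qed.

Lemma continuous_near0_ext (R : realType) (eps : R) (f g : R -> R) :
  (forall t, f t = g t) -> continuous_near0 eps f -> continuous_near0 eps g.
Proof. by move=> /funext ->. Qed.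

Definition continuous_vec (R : realType) (eps : R) (f : R -> 'rV[R]_3) : Prop :=
  forall l, continuous_near0 eps (fun t => f t 0 l).

Lemma continuous_vec_mulmx (R : realType) (eps : R) (v : 'rV[R]_3) (A : R -> 'M[R]_3) :
  (forall k l, smooth_near0 eps (fun t => A t k l)) ->
  continuous_vec eps (fun t => v *m A t).
Proof.
move=> sA l.
have cA k : continuous_near0 eps (fun t => v 0 k * A t k l).
  apply: continuous_near0M; first exact: continuous_near0_cst.
  move=> t ht; apply: differentiable_continuous; apply/derivable1_diffP.
  exact: (sA k l 0%N t ht).
apply: continuous_near0_ext (continuous_near0D (continuous_near0D (cA 0) (cA 1)) (cA 2)).
move=> t; rewrite mxE !big_ord_recl big_ord0 addr0 addrA.
by congr (v _ _ * A t _ _ + v _ _ * A t _ _ + v _ _ * A t _ _); apply/val_inj.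
Qed.

Lemma continuous_triple (R : realType) (eps : R) (f g h : R -> 'rV[R]_3) :
  continuous_vec eps f -> continuous_vec eps g -> continuous_vec eps h ->
  continuous_near0 eps (fun t => dotp (f t) (cross (g t) (h t))).
Proof.
move=> cf cg ch.
have cM u v k l : continuous_vec eps u -> continuous_vec eps v ->
    continuous_near0 eps (fun t => u t 0 k * v t 0 l).
  by move=> cu cv; exact: continuous_near0M (cu k) (cv l).
have cgh k l k' l' : continuous_near0 eps (fun t => g t 0 k * h t 0 l - g t 0 k' * h t 0 l').
  by apply: continuous_near0B; exact: cM.
apply: continuous_near0_ext (continuous_near0D (continuous_near0D
  (continuous_near0M (cf 0) (cgh 1 2 2 1)) (continuous_near0M (cf 1) (cgh 2 0 0 2)))
  (continuous_near0M (cf 2) (cgh 0 1 1 0))).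
by move=> t; rewrite dotpE3; have [-> -> ->] := crossE (g t) (h t).
Qed.

(* The inner products with the moved u and d determine the moved x up to the
   reflection in their plane; continuity excludes the reflection. *)
Lemma edge_direction_rigid (R : realType) (eps c : R) (x u d : 'rV[R]_3)
    (A B : R -> 'M[R]_3) :
  dotp x x = 1 -> orthonormal2 u d -> dotp x u = c -> dotp x d = c -> c ^+ 2 != 2^-1 ->
  (forall k l, smooth_near0 eps (fun t => A t k l)) ->
  (forall k l, smooth_near0 eps (fun t => B t k l)) ->
  A 0 = 1%:M -> B 0 = 1%:M ->
  (forall t, - eps < t < eps -> [/\ rotation_mx (A t), rotation_mx (B t),
     x *m A t = x *m B t & dotp (u *m A t) (d *m B t) = 0]) ->
  forall (G : 'M[R]_3) t, - eps < t < eps -> rotation_mx G ->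
    u *m A t = u *m G -> d *m B t = d *m G -> x *m A t = x *m G.
Proof.
move=> xx ort xu xd c0 sA sB A0 B0 AB G t ht [GG dG] uG dG'.
have [uu dd ud] := ort.
(* The squared distance of [x] from the plane of [u] and [d]; it is positive because
   [c ^+ 2 != 2^-1] keeps [x] out of that plane. *)
have gap : 0 < 1 - 2 * c ^+ 2.
  have := sqr_dotp_cross x ort; rewrite xx xu xd => e.
  rewrite lt0r; apply/andP; split; last first.
    by rewrite (_ : 1 - _ = dotp x (cross u d) ^+ 2) ?sqr_ge0 // e; ring.
  by apply: contra c0 => /eqP h; apply/eqP; lra.
pose f s := dotp (x *m A s) (cross (u *m A s) (d *m B s)).
have ortS s : - eps < s < eps -> orthonormal2 (u *m A s) (d *m B s).
  by move=> /AB [[AA _] [BB _] _ h]; split=> //; rewrite dotp_mulmx_orth.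
have fc s : - eps < s < eps -> f s ^+ 2 = 1 - 2 * c ^+ 2.
  move=> hs; have [[AA _] [BB _] e _] := AB s hs.
  rewrite /f (sqr_dotp_cross _ (ortS _ hs)) !(dotp_mulmx_orth _ _ AA) xx xu e.
  rewrite dotp_mulmx_orth // xd.
  ring.
have cf : continuous_near0 eps f.
  by apply: continuous_triple; apply: continuous_vec_mulmx.
have := constant_of_sqr gap cf fc ht.
rewrite /f A0 B0 !mulmx1 uG dG' cross_mulmx // => f0.
have [[AA _] [BB _] e _] := AB t ht.
apply: (@orthonormal_ext _ (u *m G) (d *m G)).
- by split; rewrite dotp_mulmx_orth.
- by rewrite -{1}uG !dotp_mulmx_orth.
- by rewrite e -{1}dG' !dotp_mulmx_orth.
- by rewrite cross_mulmx // f0 dotp_mulmx_orth.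
Qed.

Lemma vlen_gt0 (R : realType) (Q : nat -> nat -> quad R 2) i j :
  strictly_convex (Q i j) -> 0 < vlen Q i j.
Proof.
move=> /(@strictly_convex_frame _ _ top_right) [d [m [_ _ [h _] _ _]]].
by move: h; rewrite (_ : top_right + 1 = bottom_right) //; apply/val_inj.
Qed.

Lemma base_dots (R : realType) (V := base_directions R) :
  [/\ dotp (dir_u V) (dir_u V) = 1, dotp (dir_d V) (dir_d V) = 1,
      dotp (dir_u V) (dir_d V) = 0, dir_w V = dir_u V
    & forall j, (j <= 3)%N -> [/\ dotp (dir_e V j) (dir_e V j) = 1,
       dotp (dir_e V j) (dir_u V) = edge_dot_u R j.+1
     & dotp (dir_e V j) (dir_d V) = edge_dot_d R j.+1]].
Proof.
have r2 := sqr_half_sqrt2 R; rewrite expr2 in r2.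
have ud : dotp (dir_u V) (dir_d V) = 0 by rewrite dotp_vec3; ring.
split=> //; [by rewrite dotp_vec3; lra|by rewrite dotp_vec3; lra| |].
  have e : dotp (vec3 half_sqrt2 half_sqrt2 0) (vec3 half_sqrt2 (- half_sqrt2) 0) = 0 :> R.
    exact: ud.
  by rewrite /= /reflect_dir e mulr0 scale0r subr0.
by case=> [|[|[|[|//]]]] _; split; rewrite /= dotp_vec3; lra.
Qed.

(** Reflection turns [d] into [- d], so row 2 repeats row 1 with [w] and [- d] in place of [u] and
    [d], and [flat_and_folded] can be used there again. *)
Lemma base_edge2 (R : realType) (V := base_directions R) j : (j <= 3)%N ->
  [/\ dotp (edge2 V j) (edge2 V j) = 1,
      dotp (edge2 V j) (dir_w V) = edge_dot_u R j.+1
    & dotp (edge2 V j) (- dir_d V) = edge_dot_d R j.+1].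
Proof.
have [uu dd ud wu he] := base_dots R.
move=> j3; have [ee eu ed] := he j j3; rewrite -/V in uu dd ud wu ee eu ed.
rewrite wu /edge2 !dotp_linear (dotpC (dir_d V) (dir_e V j)) (dotpC (dir_d V) (dir_u V)).
rewrite ee eu ed dd ud !mulr1 !mulr0 !addr0.
have r2 := sqr_half_sqrt2 R; rewrite expr2 in r2.
by case: j j3 {ee eu ed} => [|[|[|[|//]]]] _ /=; rewrite ?half_sqrt2V; split=> //; lra.
Qed.

Lemma shared_edge (R : realType) (A A' : 'M[R]_3) (b b' p p' x : 'rV[R]_3) (l : R) :
  0 < l -> p' = p + l *: x ->
  p *m A + b = p *m A' + b' -> p' *m A + b = p' *m A' + b' -> x *m A = x *m A'.
Proof.
move=> l0 -> h h'.
have e (B : 'M[R]_3) c : (p + l *: x) *m B + c - (p *m B + c) = l *: (x *m B).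
  rewrite mulmxDl -scalemxAl; set X := p *m B; set Y := x *m B.
  by apply/rowP => i; rewrite !mxE; ring.
by apply: (scalerI (lt0r_neq0 l0)); rewrite -(e A b) -(e A' b') h h'.
Qed.

Section Rigidity.
Context {R : realType} (Q : nat -> nat -> quad R 2).
Context (cvxQ : forall i j, is_face 3 4 i j -> strictly_convex (Q i j)).
Context (placedQ : forall V i j, is_face 3 4 i j ->
  placed (Q i j) (face (net Q V) i j) (frame_base i j)
    (frame_D V i j) (frame_M V i j)).
Local Notation V := (base_directions R).
Local Notation p := (net Q V).
Local Notation r := (@half_sqrt2 R).

Lemma row1_edge j : (j <= 3)%N ->
  exists2 l : R, 0 < l & p 1 j.+1 = p 1 j + l *: dir_e V j.
Proof.
move=> j3; have f : is_face 3 4 1 j.+1 by [].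
have [d [m [_ _ [l0 _] _ _]]] := strictly_convex_frame bottom_right (cvxQ f).
exists (edist (Q 1 j.+1 bottom_right) (Q 1 j.+1 (bottom_right + 1))) => //.
have [] := placedQ V f; rewrite (_ : bottom_right + 1 = bottom_left); last exact/val_inj.
set l := edist _ _ => h _ _.
have {}h : p 1 j = p 1 j.+1 - l *: dir_e V j by rewrite -scalerN; exact: h.
by rewrite h subrK.
Qed.

Lemma row2_edge j : (j <= 3)%N ->
  exists2 l : R, 0 < l & p 2 j.+1 = p 2 j + l *: edge2 V j.
Proof.
move=> j3; have f : is_face 3 4 3 j.+1 by [].
have [d [m [_ _ [l0 _] _ _]]] := strictly_convex_frame top_left (cvxQ f).
exists (edist (Q 3 j.+1 top_left) (Q 3 j.+1 (top_left + 1))) => //.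
have [h _ _] := placedQ V f.
by move: h; rewrite (_ : top_left + 1 = top_right) //; apply/val_inj.
Qed.

Lemma column_edges j : (1 <= j <= 3)%N ->
  [/\ exists2 l : R, 0 < l & p 0 j = p 1 j + l *: dir_u V,
      exists2 l : R, 0 < l & p 2 j = p 1 j + l *: dir_d V
    & exists2 l : R, 0 < l & p 3 j = p 2 j + l *: dir_w V].
Proof.
move=> hj; have f i : (1 <= i <= 3)%N -> is_face 3 4 i j.
  by move=> hi; rewrite /is_face hi; case/andP: hj => -> /leqW.
have v i (hi : (1 <= i <= 3)%N) := vlen_gt0 (cvxQ (f i hi)).
case: j hj f v => [//|[|[|[|//]]]] _ _ v; split.
all: by eexists; [|reflexivity]; exact: v.
Qed.

Lemma net_not_flexible : ~ flexible 3 4 p.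
Proof.
move=> [eps [P [A [b [eps0 [P0 _ FP] nontriv]]]]]; apply: nontriv.
have [uu dd ud wu he] := base_dots R; have he2 := @base_edge2 R.
have [eu0 [ee0 ee3]] : dotp (dir_u V) (dir_u V) = 1 /\
    dir_e V 0 = - r *: (dir_u V + dir_d V) /\ dir_e V 3 = r *: (dir_u V - dir_d V).
  have [a0 a1 a2] := he 0%N isT; have [c0 c1 c2] := he 3%N isT.
  by have [_ ? ?] := flat_and_folded uu dd a0 c0 a1 a2 c1 c2.
have [ew ee0' ee3'] : [/\ dotp (dir_w V) (dir_w V) = 1,
    edge2 V 0 = - r *: (dir_w V - dir_d V) & edge2 V 3 = r *: (dir_w V + dir_d V)].
  have [a0 a1 a2] := he2 0%N isT; have [c0 c1 c2] := he2 3%N isT.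
  have ww : dotp (dir_w V) (dir_w V) = 1 by rewrite wu.
  have dd' : dotp (- dir_d V) (- dir_d V) = 1 by rewrite !dotp_linear opprK.
  by have [_] := flat_and_folded ww dd' a0 c0 a1 a2 c1 c2; rewrite opprK.
have r0 := lt0r_neq0 (half_sqrt2_gt0 R).
have r2 := sqr_half_sqrt2 R.
have mv t i j : is_face 3 4 i j -> - eps < t < eps ->
    [/\ P t i.-1 j.-1 = p i.-1 j.-1 *m A i j t + b i j t,
        P t i.-1 j = p i.-1 j *m A i j t + b i j t,
        P t i j = p i j *m A i j t + b i j t
      & P t i j.-1 = p i j.-1 *m A i j t + b i j t].
  move=> f ht; have [_ _ _ /(_ t ht) [_ _ h]] := FP i j f.
  by split; [exact: (h 0)|exact: (h 1)|exact: (h 2)|exact: (h 3)].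
have rot t i j : is_face 3 4 i j -> - eps < t < eps -> rotation_mx (A i j t).
  by move=> f ht; have [_ _ _ /(_ t ht) [AA dA _]] := FP i j f.
have smA i j : is_face 3 4 i j -> forall k l, smooth_near0 eps (fun t => A i j t k l).
  by move=> f; have [_ h _ _] := FP i j f.
have A0 i j : is_face 3 4 i j -> A i j 0 = 1%:M.
  by move=> f; have [[h _] _ _ _] := FP i j f.
have f1 j : (j <= 3)%N -> is_face 3 4 1 j.+1 by [].
have f2 j : (j <= 3)%N -> is_face 3 4 2 j.+1 by [].
have f3 j : (j <= 3)%N -> is_face 3 4 3 j.+1 by [].
have e12 t j : (j <= 3)%N -> - eps < t < eps ->
    dir_e V j *m A 1%N j.+1 t = dir_e V j *m A 2%N j.+1 t.
  move=> j3 ht; have [l l0 h] := row1_edge j3.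
  have [_ _ a1 a2] := mv t _ _ (f1 j j3) ht; have [b1 b2 _ _] := mv t _ _ (f2 j j3) ht.
  exact: (shared_edge l0 h (etrans (esym a2) b1) (etrans (esym a1) b2)).
have e23 t j : (j <= 3)%N -> - eps < t < eps ->
    edge2 V j *m A 2%N j.+1 t = edge2 V j *m A 3%N j.+1 t.
  move=> j3 ht; have [l l0 h] := row2_edge j3.
  have [_ _ a1 a2] := mv t _ _ (f2 j j3) ht; have [b1 b2 _ _] := mv t _ _ (f3 j j3) ht.
  exact: (shared_edge l0 h (etrans (esym a2) b1) (etrans (esym a1) b2)).
have col t j : (1 <= j <= 3)%N -> - eps < t < eps ->
    [/\ dir_u V *m A 1%N j t = dir_u V *m A 1%N j.+1 t,
        dir_d V *m A 2%N j t = dir_d V *m A 2%N j.+1 t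
      & dir_w V *m A 3%N j t = dir_w V *m A 3%N j.+1 t].
  move=> hj ht; have j4 : (j <= 4)%N by case/andP: hj => _ /leqW.
  have j1 : (0 < j)%N by case/andP: hj.
  have j3 : (j <= 3)%N by case/andP: hj.
  have [[l1 l10 h1] [l2 l20 h2] [l3 l30 h3]] := column_edges hj.
  have g i : (1 <= i <= 3)%N -> is_face 3 4 i j /\ is_face 3 4 i j.+1.
    by move=> hi; rewrite /is_face hi j1 j4.
  have [g1 g1'] := g 1%N isT; have [g2 g2'] := g 2%N isT; have [g3 g3'] := g 3%N isT.
  split.
  - have [_ a1 a2 _] := mv t _ _ g1 ht; have [b1 _ _ b2] := mv t _ _ g1' ht.
    exact: (shared_edge l10 h1 (etrans (esym a2) b2) (etrans (esym a1) b1)).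
  - have [_ a1 a2 _] := mv t _ _ g2 ht; have [b1 _ _ b2] := mv t _ _ g2' ht.
    exact: (shared_edge l20 h2 (etrans (esym a1) b1) (etrans (esym a2) b2)).
  - have [_ a1 a2 _] := mv t _ _ g3 ht; have [b1 _ _ b2] := mv t _ _ g3' ht.
    exact: (shared_edge l30 h3 (etrans (esym a1) b1) (etrans (esym a2) b2)).
(* Parallel column edges: along each row, neighbouring faces share an edge in the same direction, so
   all faces of the row move u (d, w) alike. *)
have uA t j : (j <= 3)%N -> - eps < t < eps ->
    [/\ dir_u V *m A 1%N j.+1 t = dir_u V *m A 1%N 1%N t,
        dir_d V *m A 2%N j.+1 t = dir_d V *m A 2%N 1%N t
      & dir_w V *m A 3%N j.+1 t = dir_w V *m A 3%N 1%N t].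
  move=> + ht; elim: j => [//|j ih] j3.
  have [i1 i2 i3] := ih (ltnW j3); have [c1 c2 c3] := col t j.+1 j3 ht.
  by rewrite -c1 -c2 -c3.
(* Each inner product required by [flat_and_folded] is measured inside a single face, so it survives
   the motion. *)
have flat t : - eps < t < eps ->
  [/\ dotp (dir_u V *m A 1%N 1%N t) (dir_d V *m A 2%N 1%N t) = 0,
      dir_d V *m A 2%N 1%N t = dir_d V *m A 1%N 1%N t
    & dir_e V 3 *m A 1%N 4%N t = dir_e V 3 *m A 1%N 1%N t].
  move=> ht.
  have [R11 _] := rot t _ _ (f1 0%N isT) ht; have [R21 _] := rot t _ _ (f2 0%N isT) ht.
  have [R14 _] := rot t _ _ (f1 3%N isT) ht; have [R24 _] := rot t _ _ (f2 3%N isT) ht.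
  have [a0 a1 a2] := he 0%N isT; have [c0 c1 c2] := he 3%N isT.
  have [u4 d4 _] := uA t 3%N isT ht.
  have [h1 h2 h3] : [/\ dotp (dir_u V *m A 1%N 1%N t) (dir_d V *m A 2%N 1%N t) = 0,
     dir_e V 0 *m A 1%N 1%N t = - r *: (dir_u V *m A 1%N 1%N t + dir_d V *m A 2%N 1%N t)
   & dir_e V 3 *m A 1%N 4%N t = r *: (dir_u V *m A 1%N 1%N t - dir_d V *m A 2%N 1%N t)].
    apply: flat_and_folded; rewrite ?dotp_mulmx_orth //.
    - by rewrite e12 // dotp_mulmx_orth.
    - by rewrite -u4 dotp_mulmx_orth.
    - by rewrite -d4 e12 // dotp_mulmx_orth.
  (* As e_0 is a multiple of u + d before and after the motion, the images of e_0 and u under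
     F_{1,1} determine the image of d. *)
  have hd : dir_d V *m A 2%N 1%N t = dir_d V *m A 1%N 1%N t.
    move: h2; rewrite ee0 -scalemxAl mulmxDl.
    have rn : - r != 0 by rewrite oppr_eq0.
    by move=> /(scalerI rn) /addrI ->.
  by split=> //; rewrite h3 hd ee3 -scalemxAl mulmxBl.
have neq (j : nat) x y : (j <= 3)%N -> dotp x x = 1 -> dotp y y = 1 ->
    dotp y x = edge_dot_u R j.+1 \/ dotp y x = edge_dot_d R j.+1 -> cross x y != 0.
  move=> j3 xx yy hxy; apply: cross_neq0 => //; rewrite dotpC.
  by apply/eqP; case: j j3 hxy => [|[|[|[|//]]]] _ [] -> /=; rewrite ?sqrrN ?r2 //; lra.
have AG t : - eps < t < eps -> forall j, (j <= 3)%N ->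
    [/\ A 1%N j.+1 t = A 1%N 1%N t, A 2%N j.+1 t = A 1%N 1%N t
      & A 3%N j.+1 t = A 1%N 1%N t].
  move=> ht; set G := A 1%N 1%N t.
  have rG : rotation_mx G := rot t _ _ (f1 0%N isT) ht; have [GG _] := rG.
  have [_ dG e3G] := flat t ht.
  have eG j : (j <= 3)%N -> dir_e V j *m A 1%N j.+1 t = dir_e V j *m G.
    move=> j3; have [a0 a1 a2] := he j j3; have [c1 c2 _] := uA t j j3 ht.
    (* This serves e_1 and e_2, the only edges of the row off the plane of u and d; e_0 is moved by
       [G] itself and e_3 is covered by [flat]. *)
    have rigid : edge_dot_u R j.+1 = edge_dot_d R j.+1 ->
        edge_dot_u R j.+1 ^+ 2 != 2^-1 -> dir_e V j *m A 1%N j.+1 t = dir_e V j *m G.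
      move=> cc c; rewrite -cc in a2.
      have h := edge_direction_rigid a0 (And3 uu dd ud) a1 a2 c (smA _ _ (f1 j j3))
        (smA _ _ (f2 j j3)) (A0 _ _ (f1 j j3)) (A0 _ _ (f2 j j3)).
      apply: h ht rG _ _ => //; last by rewrite c2.
      move=> s hs; have [k1 k2 _] := uA s j j3 hs; have [k3 _ _] := flat s hs.
      split; [exact: rot (f1 j j3) hs|exact: rot (f2 j j3) hs|exact: e12|].
      by rewrite k1 k2.
    have half : (2^-1 : R) ^+ 2 != 2^-1 by apply/eqP; lra.
    move: rigid; case: j j3 {a0 a1 a2 c1 c2} => [//|[|[|[|//]]]] _ /= rigid.
    - by apply: rigid; rewrite ?sqrrN.
    - exact: rigid.
    - exact: e3G.
  have A1G j : (j <= 3)%N -> A 1%N j.+1 t = G.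
    move=> j3; have [a0 a1 _] := he j j3; have [c1 _ _] := uA t j j3 ht.
    apply: (rotation_mx_eq (rot t _ _ (f1 j j3) ht) rG _ c1 (eG j j3)).
    by apply: (neq j) => //; left.
  have A2G j : (j <= 3)%N -> A 2%N j.+1 t = G.
    move=> j3; have [a0 _ a2] := he j j3; have [_ c2 _] := uA t j j3 ht.
    have e2G : dir_e V j *m A 2%N j.+1 t = dir_e V j *m G by rewrite -e12 // eG.
    apply: (rotation_mx_eq (rot t _ _ (f2 j j3) ht) rG _ (etrans c2 dG) e2G).
    by apply: (neq j) => //; right.
  have [R31 _] := rot t _ _ (f3 0%N isT) ht.
  (* Once the first two rows move by [G], the flat edge of row 2 recovers the image of [w] from
     those of [edge2 V 0] and [d]. *)
  have wG : dir_w V *m A 3%N 1%N t = dir_w V *m G.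
    have [a0 a1 a2] := he2 0%N isT; have [c0 c1 c2] := he2 3%N isT.
    have [R34 _] := rot t _ _ (f3 3%N isT) ht; have [_ _ w4] := uA t 3%N isT ht.
    have g0 : edge2 V 0 *m A 3%N 1%N t = edge2 V 0 *m G by rewrite -e23 // A2G.
    have g3 : edge2 V 3 *m A 3%N 4%N t = edge2 V 3 *m G by rewrite -e23 // A2G.
    have [_ h _] : [/\ dotp (dir_w V *m A 3%N 1%N t) (- dir_d V *m G) = 0,
       edge2 V 0 *m G = - r *: (dir_w V *m A 3%N 1%N t + - dir_d V *m G)
     & edge2 V 3 *m G = r *: (dir_w V *m A 3%N 1%N t - - dir_d V *m G)].
      apply: flat_and_folded; rewrite ?dotp_mulmx_orth //.
      - by rewrite !dotp_linear opprK.
      - by rewrite -g0 dotp_mulmx_orth.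
      - by rewrite -w4 -g3 dotp_mulmx_orth.
    move: h; rewrite ee0' -scalemxAl mulmxBl mulNmx.
    have rn : - r != 0 by rewrite oppr_eq0.
    by move=> /(scalerI rn) /addIr ->.
  move=> j j3; split; [exact: A1G|exact: A2G|].
  have [a0 a1 _] := he2 j j3; have [_ _ c3] := uA t j j3 ht.
  have e3G' : edge2 V j *m A 3%N j.+1 t = edge2 V j *m G by rewrite -e23 // A2G.
  apply: (rotation_mx_eq (rot t _ _ (f3 j j3) ht) rG _ (etrans c3 wG) e3G').
  by apply: (neq j) => //; left.
have AE t i j : is_face 3 4 i j -> - eps < t < eps -> A i j t = A 1%N 1%N t.
  move=> /is_face34P[hi hj] ht.
  have [k k3 ->] : exists2 k, (k <= 3)%N & j = k.+1.
    by case: hj => ->; [exists 0%N|exists 1%N|exists 2%N|exists 3%N].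
  by have [? ? ?] := AG t ht k k3; case: hi => ->.
(* Equal rotations and a common vertex force equal translations. *)
have bcol t i j : is_face 3 4 i j -> is_face 3 4 i j.+1 -> - eps < t < eps ->
    b i j.+1 t = b i j t.
  move=> f f' ht; have [_ _ h _] := mv t _ _ f ht; have [_ _ _ h'] := mv t _ _ f' ht.
  by move: h'; rewrite h (AE t _ _ f ht) (AE t _ _ f' ht) => /addrI.
have brow t i j : is_face 3 4 i j -> is_face 3 4 i.+1 j -> - eps < t < eps ->
    b i.+1 j t = b i j t.
  move=> f f' ht; have [_ _ h _] := mv t _ _ f ht; have [_ h' _ _] := mv t _ _ f' ht.
  by move: h'; rewrite h (AE t _ _ f ht) (AE t _ _ f' ht) => /addrI.
have bE t i j : is_face 3 4 i j -> - eps < t < eps -> b i j t = b 1%N 1%N t.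
  move=> + ht; have c j' : (j' <= 3)%N -> b 1%N j'.+1 t = b 1%N 1%N t.
    elim: j' => [//|j' ih] j3.
    by rewrite (bcol t _ _ (f1 _ (ltnW j3)) (f1 _ j3) ht) ih // ltnW.
  move=> /is_face34P[hi hj].
  have [k k3 ->] : exists2 k, (k <= 3)%N & j = k.+1.
    by case: hj => ->; [exists 0%N|exists 1%N|exists 2%N|exists 3%N].
  have b2 : b 2%N k.+1 t = b 1%N 1%N t by rewrite (brow t _ _ (f1 _ k3) (f2 _ k3) ht) c.
  by case: hi => ->; [exact: c|exact: b2|rewrite (brow t _ _ (f2 _ k3) (f3 _ k3) ht)].
move=> i j i' j' t f f' ht.
by rewrite (AE t _ _ f ht) (AE t _ _ f' ht) (bE t _ _ f ht) (bE t _ _ f' ht).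
Qed.
End Rigidity.

(** * Dihedral angles *)

Lemma lin_entry (R : realType) n (a b : R) (v w : 'rV[R]_n) k :
  (a *: v + b *: w) 0 k = a * v 0 k + b * w 0 k.
Proof. by rewrite !mxE. Qed.

Lemma cross_linr (R : realType) (u v w : 'rV[R]_3) a b :
  cross u (a *: v + b *: w) = a *: cross u v + b *: cross u w.
Proof.
have [c0 c1 c2] := crossE u v; have [c0' c1' c2'] := crossE u w.
have [d0 d1 d2] := crossE u (a *: v + b *: w).
by apply: row3P; rewrite ?d0 ?d1 ?d2 !lin_entry ?c0 ?c1 ?c2 ?c0' ?c1' ?c2'; ring.
Qed.

Lemma crossvv (R : realType) (u : 'rV[R]_3) : cross u u = 0.
Proof.
have [c0 c1 c2] := crossE u u.
by apply: row3P; rewrite ?c0 ?c1 ?c2 [RHS]mxE; ring.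
Qed.

Lemma rotation_linear (R : realType) (u : 'rV[R]_3) (theta : R) (v w : 'rV[R]_3) a b :
  rotation u theta (a *: v + b *: w) = a *: rotation u theta v + b *: rotation u theta w.
Proof.
rewrite /rotation cross_linr !dotp_linear.
set X := cross u v; set Y := cross u w.
by apply/rowP => k; rewrite !mxE; ring.
Qed.

Lemma rotation_axis (R : realType) (u : 'rV[R]_3) (theta : R) :
  dotp u u = 1 -> rotation u theta u = u.
Proof.
move=> uu; rewrite /rotation uu crossvv scaler0 addr0 mulr1 -scalerDl.
by rewrite addrC subrK scale1r.
Qed.

Lemma rotation_perp (R : realType) (D y : 'rV[R]_3) (theta : R) :
  dotp D D = 1 ->
  rotation D theta (y - dotp D y *: D) =
  cos theta *: (y - dotp D y *: D) + sin theta *: cross D y.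
Proof.
move=> DD; rewrite /rotation !dotp_linear DD mulr1 subrr mulr0 scale0r addr0.
congr (_ + _ *: _); rewrite -[y]scale1r -scaleNr cross_linr crossvv scaler0 addr0.
by rewrite !scale1r.
Qed.

Lemma half_plane_flip (R : realType) (a D w : 'rV[R]_3) (e : R) x :
  half_plane (a + e *: D) (- D) w x -> half_plane a D w x.
Proof.
move=> [s [t [t0 ->]]]; exists (e - s), t; split=> //.
by rewrite scalerN scalerBl addrA.
Qed.

(** The faces are represented by directions [yl], [yr] pointing to their sides of the edge; it
    suffices that the rotation turns one orthogonal component into the opposite of the other. The
    condition on [dotp D yl] keeps that component nonzero. *)
Lemma exterior_dihedral_angleI (R : realType) (a b D yl yr : 'rV[R]_3)
    (l r : quad R 3) (theta e : R) :
  dotp D D = 1 -> 0 < e -> b = a + e *: D ->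
  dotp yl yl = 1 -> dotp D yl ^+ 2 != 1 ->
  (forall k, half_plane a D (yl - dotp D yl *: D) (l k)) ->
  (forall k, half_plane a D (yr - dotp D yr *: D) (r k)) ->
  rotation D theta (yr - dotp D yr *: D) = - (yl - dotp D yl *: D) ->
  exterior_dihedral_angle a b l r theta.
Proof.
move=> DD e0 -> yy Dy hl hr hrot.
have eE : edist a (a + e *: D) = e.
  rewrite /edist /enorm addrC addKr !dotp_linear DD mulr1 -expr2 sqrtr_sqr.
  by rewrite gtr0_norm.
have uE : (edist a (a + e *: D))^-1 *: (a + e *: D - a) = D.
  by rewrite eE addrC addKr scalerK ?lt0r_neq0.
rewrite /exterior_dihedral_angle uE.
exists (yl - dotp D yl *: D); split=> //.
- apply: contra Dy => /eqP w0; have := congr1 (dotp yl) w0.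
  rewrite !dotp_linear yy (dotpC yl D) => h.
  have -> : dotp D yl ^+ 2 = 1.
    have z : dotp yl 0 = 0 by rewrite -(scale0r yl) dotpZr mul0r.
    by move: h; rewrite z => /eqP; rewrite subr_eq0 eq_sym -expr2 => /eqP.
  by rewrite eqxx.
- by rewrite !dotp_linear DD mulr1 subrr.
- move=> k; have [s [t [t0 ->]]] := hr k.
  have sub (x y : 'rV[R]_3) : x + y - x = y by rewrite addrC addKr.
  by exists s, t; rewrite -(addrA a) sub rotation_linear rotation_axis // hrot addrA.
Qed.

(** The orthogonal directions u and d both make the angle 2 pi / 3 with e_1 and pi / 3 with e_2. By
    the spherical law of cosines the interior dihedral angle has cosine (0 - 1/4) / (3/4) = - 1/3,
    so the exterior one has cosine 1/3. At e_0, a multiple of u + d, the components of u and d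
    orthogonal to the edge are opposite; at e_3, a multiple of u - d, they coincide. *)
Definition base_phi (R : realType) (j : nat) : R :=
  match j with 0 => 0 | 1 | 2 => - acos 3^-1 | _ => pi end.

Lemma cos_sin_acos3 (R : realType) :
  cos (- acos (3^-1 : R)) = 3^-1 /\ sin (- acos (3^-1 : R)) = - (4 / 3 * half_sqrt2).
Proof.
have b : -1 <= (3^-1 : R) <= 1 by apply/andP; split; lra.
rewrite cosN sinN acosK ?in_itv //= sin_acos //; split=> //; congr (- _).
have r0 := half_sqrt2_gt0 R; have r2 := sqr_half_sqrt2 R.
have -> : 1 - (3^-1 : R) ^+ 2 = (4 / 3 * half_sqrt2) ^+ 2.
  by rewrite exprMn r2; field.
by rewrite sqrtr_sqr gtr0_norm // mulr_gt0 // divr_gt0.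
Qed.

Lemma base_rotation (R : realType) (V := base_directions R) j (i : bool)
    (D := if i then dir_e V j else edge2 V j)
    (yl := if i then dir_u V else - dir_d V)
    (yr := if i then dir_d V else dir_w V) : (j <= 3)%N ->
  rotation D (base_phi R j) (yr - dotp D yr *: D) = - (yl - dotp D yl *: D).
Proof.
have [uu dd ud wu he] := base_dots R; have he2 := @base_edge2 R.
have [c3 s3] := cos_sin_acos3 R.
have r2 := sqr_half_sqrt2 R; rewrite expr2 in r2.
pose r : R := half_sqrt2; rewrite -/r in r2 s3.
(* All powers of [r] that occur reduce to rational multiples of 1 and [r], which makes the
   coordinate identities linear. *)
have r3 : r * r * r = 2^-1 * r by rewrite r2.
have r4 : r * r * r * r = 4^-1 by rewrite r3 -mulrA r2; field.
have r5 : r * r * r * r * r = 4^-1 * r by rewrite r4.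
move=> j3; rewrite /D /yl /yr {D yl yr}.
have main (D yl yr : 'rV[R]_3) (a b c s th : R) : dotp D D = 1 -> dotp D yl = a ->
   dotp D yr = b -> cos th = c -> sin th = s ->
   c * (yr 0 0 - b * D 0 0) + s * (D 0 1 * yr 0 2 - D 0 2 * yr 0 1) = - (yl 0 0 - a * D 0 0) ->
   c * (yr 0 1 - b * D 0 1) + s * (D 0 2 * yr 0 0 - D 0 0 * yr 0 2) = - (yl 0 1 - a * D 0 1) ->
   c * (yr 0 2 - b * D 0 2) + s * (D 0 0 * yr 0 1 - D 0 1 * yr 0 0) = - (yl 0 2 - a * D 0 2) ->
   rotation D th (yr - dotp D yr *: D) = - (yl - dotp D yl *: D).
  move=> DD hl hr hc hs h0 h1 h2; rewrite rotation_perp // hl hr hc hs.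
  have ent (x y : 'rV[R]_3) e k : (x - e *: y) 0 k = x 0 k - e * y 0 k by rewrite !mxE.
  have entN (x y : 'rV[R]_3) e k : (- (x - e *: y)) 0 k = - (x 0 k - e * y 0 k).
    by rewrite !mxE.
  have [c0 c1 c2] := crossE D yr.
  by apply: row3P; rewrite lin_entry ent entN ?c0 ?c1 ?c2.
have [e0 e1 e2 e3] : [/\ edge2 V 0 = vec3 0 (-1) 0, edge2 V 1 = vec3 0 (- r) r,
    edge2 V 2 = vec3 0 r r & edge2 V 3 = vec3 1 0 0].
  split; rewrite /edge2 /V /= ?half_sqrt2V -/r; apply: row3P; rewrite !mxE /=; lra.
have cosN1 : cos (pi : R) = -1 := cospi R.
case: i.
- have [a0 a1 a2] := he j j3.
  case: j j3 a0 a1 a2 => [|[|[|[|//]]]] _ /= a0 a1 a2.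
  + by have := (main _ _ _ _ _ _ _ _ a0 a1 a2 (cos0 R) (sin0 R));
      apply; rewrite !mxE /= -/r; lra.
  + by have := (main _ _ _ _ _ _ _ _ a0 a1 a2 c3 s3);
      apply; rewrite !mxE /= -/r; lra.
  + by have := (main _ _ _ _ _ _ _ _ a0 a1 a2 c3 s3);
      apply; rewrite !mxE /= -/r; lra.
  + by have := (main _ _ _ _ _ _ _ _ a0 a1 a2 (cospi R) (sinpi R));
      apply; rewrite !mxE /= -/r; lra.
- have [a0 a1 a2] := he2 j j3; rewrite wu in a1 *.
  case: j j3 a0 a1 a2 => [|[|[|[|//]]]] _ /=.
  + rewrite e0 => a0 a1 a2.
    by have := (main _ _ _ _ _ _ _ _ a0 a2 a1 (cos0 R) (sin0 R));
      apply; rewrite !mxE /= -/r; lra.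
  + rewrite e1 => a0 a1 a2.
    by have := (main _ _ _ _ _ _ _ _ a0 a2 a1 c3 s3);
      apply; rewrite !mxE /= -/r; lra.
  + rewrite e2 => a0 a1 a2.
    by have := (main _ _ _ _ _ _ _ _ a0 a2 a1 c3 s3);
      apply; rewrite !mxE /= -/r; lra.
  + rewrite e3 => a0 a1 a2.
    by have := (main _ _ _ _ _ _ _ _ a0 a2 a1 (cospi R) (sinpi R));
      apply; rewrite !mxE /= -/r; lra.
Qed.

Section Dihedral.
Context {R : realType} (Q : nat -> nat -> quad R 2).
Context (cvxQ : forall i j, is_face 3 4 i j -> strictly_convex (Q i j)).
Context (placedQ : forall V i j, is_face 3 4 i j ->
  placed (Q i j) (face (net Q V) i j) (frame_base i j)
    (frame_D V i j) (frame_M V i j)).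
Local Notation V := (base_directions R).
Local Notation p := (net Q V).

(** The cyclic order of the face runs along its bottom side from right to left, so the half-plane is
    found for [- D] from the right end and then flipped. *)
Lemma half_plane_above i j (D y : 'rV[R]_3) :
  is_face 3 4 i j.+1 -> dotp D D = 1 ->
  (exists2 l : R, 0 < l & p i j.+1 = p i j + l *: D) ->
  (forall c, (1 <= c <= 3)%N -> exists2 v : R, 0 < v & p i.-1 c = p i c + v *: y) ->
  forall k, half_plane (p i j) D (y - dotp D y *: D) (face p i j.+1 k).
Proof.
move=> f DD [l l0 hl] hv k.
have im := net_image cvxQ placedQ f (base_rigid R (proj2 (andP f))).
have DD' : dotp (- D) (- D) = 1 by rewrite !dotp_linear opprK.
have hl' : p i j = p i j.+1 + l *: - D by rewrite hl scalerN addrK.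
have -> : y - dotp D y *: D = y - dotp (- D) y *: - D.
  by rewrite dotpNl scaleNr scalerN opprK.
apply: (@half_plane_flip _ _ _ _ l); rewrite -hl.
have [m [s [v [mk v0 hm]]]] : exists m s v, [/\ m = bottom_right + 2 \/ m = bottom_right + 3,
    0 < v & face p i j.+1 m = p i j.+1 + (s *: - D + v *: y)].
  (* The outer sides of columns 1 and 4 need not be parallel to [y], so the test vertex is taken on
     an interior column line: the right side of the face if [j = 0], its left side otherwise. *)
  have [j0|j1] := posnP j.
    have [v v0 h] := hv j.+1 ltac:(by rewrite j0).
    exists top_right, 0, v; split=> //; first by right; apply/val_inj.
    by rewrite scale0r add0r -h.
  have j3 : (1 <= j <= 3)%N by rewrite j1; case/andP: f => _ /andP[_].
  have [v v0 h] := hv j j3.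
  exists top_left, l, v; split=> //; first by left; apply/val_inj.
  by rewrite addrA -hl' -h.
apply: (@strictly_convex_half_plane _ _ _ bottom_right m (- D) y l s v
  mk (cvxQ f) im DD' l0 _ v0 hm).
by rewrite (_ : bottom_right + 1 = bottom_left) //; apply/val_inj.
Qed.

Lemma half_plane_below i j (D y : 'rV[R]_3) :
  is_face 3 4 i.+1 j.+1 -> dotp D D = 1 ->
  (exists2 l : R, 0 < l & p i j.+1 = p i j + l *: D) ->
  (forall c, (1 <= c <= 3)%N -> exists2 v : R, 0 < v & p i.+1 c = p i c + v *: y) ->
  forall k, half_plane (p i j) D (y - dotp D y *: D) (face p i.+1 j.+1 k).
Proof.
move=> f DD [l l0 hl] hv k.
have im := net_image cvxQ placedQ f (base_rigid R (proj2 (andP f))).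
have [m [s [v [mk v0 hm]]]] : exists m s v, [/\ m = top_left + 2 \/ m = top_left + 3,
    0 < v & face p i.+1 j.+1 m = p i j + (s *: D + v *: y)].
  have [j0|j1] := posnP j.
    have [v v0 h] := hv j.+1 ltac:(by rewrite j0).
    exists bottom_right, l, v; split=> //; first by left; apply/val_inj.
    by rewrite addrA -hl -h.
  have j3 : (1 <= j <= 3)%N by rewrite j1; case/andP: f => _ /andP[_].
  have [v v0 h] := hv j j3.
  exists bottom_left, 0, v; split=> //; first by right; apply/val_inj.
  by rewrite scale0r add0r -h.
apply: (@strictly_convex_half_plane _ _ _ top_left m D y l s v mk (cvxQ f) im DD l0 _ v0 hm).
by rewrite (_ : top_left + 1 = top_right) //; apply/val_inj.
Qed.

Lemma net_row_dihedral_angle i j : (1 <= i <= 2)%N -> (j <= 3)%N ->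
  row_dihedral_angle p i j (base_phi R j).
Proof.
move=> hi j3; have [uu dd ud wu he] := base_dots R; have he2 := @base_edge2 R.
have r2 := sqr_half_sqrt2 R; rewrite expr2 in r2.
have up1 c hc := let: And3 h _ _ := column_edges cvxQ (j := c) hc in h.
have down1 c hc := let: And3 _ h _ := column_edges cvxQ (j := c) hc in h.
have down2 c hc := let: And3 _ _ h := column_edges cvxQ (j := c) hc in h.
have up2 c : (1 <= c <= 3)%N -> exists2 v : R, 0 < v & p 1 c = p 2 c + v *: - dir_d V.
  by move=> /down1 [v v0 h]; exists v; rewrite // h scalerN addrK.
case: i hi => [//|[|[|//]]] _.
- have [ee eu ed] := he j j3; have [l l0 hl] := row1_edge cvxQ placedQ j3.
  apply: (exterior_dihedral_angleI ee l0 hl uu _ _ _ (@base_rotation R j true j3)).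
  + apply/eqP; rewrite eu; case: j {eu ed ee hl} j3 => [|[|[|[|//]]]] _ /=; lra.
  + by apply: half_plane_above => //; exists l.
  + by apply: half_plane_below => //; exists l.
- have [ee eu ed] := he2 j j3; have [l l0 hl] := row2_edge cvxQ placedQ j3.
  have dd' : dotp (- dir_d V) (- dir_d V) = 1 by rewrite !dotp_linear opprK.
  apply: (exterior_dihedral_angleI ee l0 hl dd' _ _ _ (@base_rotation R j false j3)).
  + apply/eqP; rewrite ed; case: j {eu ed ee hl} j3 => [|[|[|[|//]]]] _ /=; lra.
  + by apply: half_plane_above => //; exists l.
  + by apply: half_plane_below => //; exists l.
Qed.

End Dihedral.

Theorem theorem6 (R : realType) (Q : nat -> nat -> quad R 2) :
  let alpha : R := pi / 4 in
  let beta : R := 2 * pi / 3 in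
  let gamma : R := pi / 3 in
  let delta : R := pi / 4 in
  net_of_quads 3 4 Q ->
  (forall i, (1 <= i <= 2)%N ->
    [/\ angle (Q i 1%N) bottom_right = alpha,
        angle (Q i.+1 1%N) top_right = alpha,
        angle (Q i 2%N) bottom_left = beta
      & angle (Q i.+1 2%N) top_left = beta]) ->
  (forall i, (1 <= i <= 2)%N ->
    [/\ angle (Q i 2%N) bottom_right = gamma,
        angle (Q i.+1 2%N) top_right = gamma,
        angle (Q i 3%N) bottom_left = gamma
      & angle (Q i.+1 3%N) top_left = gamma]) ->
  (forall i, (1 <= i <= 2)%N ->
      angle (Q i 3%N) bottom_right = beta
      /\ angle (Q i.+1 3%N) top_right = beta) ->
  [/\ angle (Q 2%N 4%N) top_left = 2 * alpha + delta,
      angle (Q 2%N 4%N) bottom_left = 2 * alpha + delta,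
      angle (Q 1%N 4%N) bottom_left = delta
    & angle (Q 3%N 4%N) top_left = delta] ->
  exists (p : vertices R) (phi : nat -> R),
    [/\ realization 3 4 Q p,
        (forall i j, (1 <= i <= 2)%N -> (j <= 3)%N ->
           row_dihedral_angle p i j (phi j)),
        [/\ phi 0%N = 0, phi 1%N = phi 2%N & phi 3%N = pi],
        ~ flexible 3 4 p
      & flexible 3 3 p /\ flexible 3 3 (drop_columns 1 p)].
Proof.
move=> alpha beta gamma delta netQ angles1 angles2 angles3 angles4.
have cvxQ : forall i j, is_face 3 4 i j -> strictly_convex (Q i j) by case: netQ.
have placedQ := placed_net netQ angles1 angles2 angles3 angles4.
exists (net Q (base_directions R)), (base_phi R); split=> //.
- have im i j : is_face 3 4 i j ->
      isometric_image (Q i j) (face (net Q (base_directions R)) i j).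
    by move=> f; apply: (net_image cvxQ placedQ f (base_rigid R _)); case/andP: f.
  split=> i j f; last exact: image_congruent (im i j f).
  split; first exact: image_coplanar (im i j f).
  exact: image_simple (im i j f) (strictly_convex_simple (cvxQ i j f)).
- by move=> i j; exact: net_row_dihedral_angle.
- exact: net_not_flexible.
- split.
    (* Both families pass through the base directions at [t = 0], so the same realization is flexed
       in two ways, with column offset 0 and 1. *)
    rewrite -left_directions0.
    apply: (@net_flexible _ _ cvxQ placedQ _ 0 3) => //.
    + by move=> t ht j hj; exact: left_rigid.
    + exact: smooth_left.
    + by rewrite left_directions0 base_dotp_ud.
    + by move=> t; exact: left_dotp_ud.
  rewrite -right_directions0.
  apply: (@net_flexible _ _ cvxQ placedQ _ 1 3) => //.
  + by move=> t ht j hj; exact: right_rigid.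
  + exact: smooth_right.
  + by rewrite right_directions0 base_dotp_ud.
  + by move=> t; exact: right_dotp_ud.
Qed.
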